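(* Let $\mathbb{F}$ be a finite field of characteristic $2$. There is an algorithm which, given a multilinear polynomial $P\in\mathbb{F}[x_1,\dots,x_m]$, returns a symmetric matrix $M$ with entries in $\mathbb{F}\cup\{x_1,\dots,x_m\}$ such that $\det(M)=P$ whenever such a matrix exists. The algorithm runs in time polynomial in $m$ and in the number of monomials of $P$.
   Context: A polynomial is multilinear if each of its monomials has degree at most $1$ in each variable. *)

(* Defs.v *)
From mathcomp Require Import all_boot all_order all_algebra all_field.
From mathcomp Require Import mpoly.

Set Implicit Arguments.
Unset Strict Implicit.
Unset Printing Implicit Defensive.

Import GRing.Theory.
Local Open Scope ring_scope.

(* The model of computation: a first-order, call-by-value functional language
   with general recursion over binary trees.  A program is a finite list of
   bodies of one-argument functions, which may call one another; function 0 is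
   the entry point.  Variables are de Bruijn indices. *)

Inductive tree : Type :=
| Leaf
| Node of tree & tree.

Fixpoint tree_size (v : tree) : nat :=
  if v is Node v1 v2 then (tree_size v1 + tree_size v2).+1 else 1%N.

Inductive exp : Type :=
| EVar of nat
| ELeaf
| ENode of exp & exp
| ECase of exp & exp & exp
| ELet of exp & exp
| ECall of nat & exp.

Definition program := seq exp.

(* [eval p env e v t]: in environment [env], [e] evaluates to [v] in time [t].
   Reading a variable copies its value and costs the size of that value; every
   other construct costs 1.  Without the charge for copying, sharing would let
   a program build trees of exponential size in linear time. *)
Inductive eval (p : program) : seq tree -> exp -> tree -> nat -> Prop :=
| eval_var env i :
    eval p env (EVar i) (nth Leaf env i) (tree_size (nth Leaf env i))
| eval_leaf env :
    eval p env ELeaf Leaf 1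
| eval_node env e1 e2 v1 v2 t1 t2 :
    eval p env e1 v1 t1 -> eval p env e2 v2 t2 ->
    eval p env (ENode e1 e2) (Node v1 v2) (t1 + t2).+1
| eval_case_leaf env e e0 e1 v t t0 :
    eval p env e Leaf t -> eval p env e0 v t0 ->
    eval p env (ECase e e0 e1) v (t + t0).+1
| eval_case_node env e e0 e1 v1 v2 v t t1 :
    eval p env e (Node v1 v2) t -> eval p [:: v1, v2 & env] e1 v t1 ->
    eval p env (ECase e e0 e1) v (t + t1).+1
| eval_let env e1 e2 v1 v2 t1 t2 :
    eval p env e1 v1 t1 -> eval p (v1 :: env) e2 v2 t2 ->
    eval p env (ELet e1 e2) v2 (t1 + t2).+1
| eval_call env f e v w t1 t2 :
    eval p env e v t1 -> eval p [:: v] (nth ELeaf p f) w t2 ->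
    eval p env (ECall f e) w (t1 + t2).+1.

Definition run (p : program) (x y : tree) (t : nat) : Prop :=
  eval p [:: x] (ECall 0 (EVar 0)) y t.

Lemma eval_det p env e v t w u :
  eval p env e v t -> eval p env e w u -> v = w /\ t = u.
Proof.
move=> ev; move: w u; induction ev; move=> w' u ev'; inversion ev'; subst => //.
all: match goal with H : _ |- _ => case: (IHev1 _ _ H) => eqv eqt end.
all: try discriminate; try (injection eqv as ? ?); subst.
all: by match goal with H : _ |- _ => case: (IHev2 _ _ H) => -> -> end.
Qed.

Lemma eval_size p env e v t : eval p env e v t -> (tree_size v <= t)%N.
Proof.
elim=> {env e v t} //= *; rewrite ?ltnS ?leq_add //;
  by apply: leqW; apply: leq_trans (leq_addl _ _).
Qed.

Fixpoint enc_nat (n : nat) : tree :=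
  if n is n'.+1 then Node Leaf (enc_nat n') else Leaf.

Definition enc_seq (T : Type) (f : T -> tree) (s : seq T) : tree :=
  foldr (fun x v => Node (f x) v) Leaf s.

(* [F] is fixed before the algorithm, so the encoding of a scalar has size
   O(1), and a program can contain the operation tables of [F]. *)
Definition enc_scalar (F : finFieldType) (a : F) : tree :=
  enc_nat (enum_rank a).

Definition enc_monomial (m : nat) (u : 'X_{1..m}) : tree :=
  enc_seq (fun i : 'I_m => enc_nat (u i)) (enum 'I_m).

(* Sparse representation: [m], then the monomials of [P], listed in [s], with
   their coefficients. *)
Definition enc_poly (F : finFieldType) (m : nat) (P : {mpoly F[m]})
    (s : seq 'X_{1..m}) : tree :=
  Node (enc_nat m)
    (enc_seq (fun u => Node (enc_monomial u) (enc_scalar P@_u)) s).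

Definition multilinear (F : finFieldType) (m : nat) (P : {mpoly F[m]}) : Prop :=
  forall u : 'X_{1..m}, u \in msupp P -> forall i : 'I_m, (u i <= 1)%N.

(* [inl a] stands for the constant [a] and [inr k] for the variable [x_k]. *)
Definition entry (F : finFieldType) (m : nat) : Type := (F + 'I_m)%type.

Definition entry_poly (F : finFieldType) (m : nat) (x : entry F m) :
    {mpoly F[m]} :=
  match x with inl a => a%:MP | inr k => 'X_k end.

Definition enc_entry (F : finFieldType) (m : nat) (x : entry F m) : tree :=
  match x with
  | inl a => Node (enc_nat 0) (enc_scalar a)
  | inr k => Node (enc_nat 1) (enc_nat k)
  end.

Definition enc_matrix (F : finFieldType) (m n : nat) (M : 'M[entry F m]_n) :
    tree :=
  enc_seq (fun i : 'I_n =>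
    enc_seq (fun j : 'I_n => enc_entry (M i j)) (enum 'I_n)) (enum 'I_n).

Definition is_SDR (F : finFieldType) (m n : nat) (P : {mpoly F[m]})
    (M : 'M[entry F m]_n) : Prop :=
  [/\ (0 < n)%N, M^T = M & \det (map_mx (@entry_poly F m) M) = P].

(* Main.v *)
Require Import Defs.
From mathcomp Require Import all_boot all_order all_algebra all_field.
From mathcomp Require Import mpoly.
From mathcomp Require Import fingroup perm zify.

Set Implicit Arguments.
Unset Strict Implicit.
Unset Printing Implicit Defensive.

Import GRing.Theory.
Local Open Scope ring_scope.

(* In characteristic 2 the determinant of a symmetric matrix is a sum over
   involutions, so it depends only on the diagonal and on the squares of the
   off-diagonal entries.  Modulo the squares x_i^2 the variables off the diagonal
   thus disappear, and a multilinear P with a representation is the determinant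
   of a symmetric matrix with each variable once, on the diagonal, and constants
   elsewhere.  Let T be any monomial of P, with coefficient c.  Pivoting on the
   complement of T yields a symmetric m x m matrix A over F such that, for every
   set U of variables, the coefficient of x^U in P is c times the principal minor
   of A on the symmetric difference of U and T.  The minors of size 1 and 2 give
   A_ii and A_ij^2, and square roots are unique, so at most 1 + m + m^2
   coefficients of P determine A.  Conversely, a fixed symmetric gadget of size
   3m + 1 built from A, T and c has determinant P. *)

(** * Determinants in characteristic 2 *)

Lemma big_involution (V : Type) (idx : V) (op : Monoid.com_law idx)
    (I : finType) (phi : I -> I) (F : I -> V) : involutive phi ->
  \big[op/idx]_x F x =
    op (\big[op/idx]_(x | phi x == x) F x)
       (\big[op/idx]_(x | (enum_rank x < enum_rank (phi x))%N)
          op (F x) (F (phi x))).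
Proof.
move=> phiK; rewrite (bigID (fun x => phi x == x)) /=; congr (op _ _).
(* Each two-element orbit is represented by its point of smaller rank. *)
rewrite (bigID (fun x => enum_rank x < enum_rank (phi x))%N) /= big_split /=.
congr (op _ _).
  apply: eq_bigl => x; case: eqVneq => //= ->.
  by rewrite ltnn.
rewrite (reindex_inj (inv_inj phiK)); apply: eq_bigl => x /=.
rewrite phiK -leqNgt leq_eqVlt eq_sym.
by case: (eqVneq (phi x) x) => [->|ne]; rewrite ?ltnn // (inj_eq val_inj)
  (inj_eq enum_rank_inj) eq_sym (negPf ne).
Qed.

Section CharTwo.

Variable R : comNzRingType.
Hypothesis R2 : 2%N \in [pchar R].

(** By symmetry a permutation and its inverse contribute equal terms, which cancel in characteristic
    2 unless the permutation is an involution. Each 2-cycle then gives the square of one entry. *)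
Lemma det_sym_pchar2 n (S : 'M[R]_n) : S^T = S ->
  \det S = \sum_(s : 'S_n | s^-1%g == s)
    (\prod_(i | s i == i) S i i) *
    \prod_(i | (enum_rank i < enum_rank (s i))%N) S i (s i) ^+ 2.
Proof.
move=> symS; have S_C i j : S i j = S j i by rewrite -{1}symS mxE.
have ->: \det S = \sum_(s : 'S_n) \prod_i S i (s i).
  by apply: eq_bigr => s _; rewrite oppr_pchar2 // expr1n mul1r.
rewrite (big_involution _ _ (@invgK _)) /= [X in _ + X]big1 ?addr0 => [|s _].
  apply: eq_bigr => s /eqP sV.
  have sK : involutive s by move=> i; rewrite -{1}sV permK.
  rewrite (big_involution _ _ sK) /=; congr (_ * _).
    by apply: eq_bigr => i /eqP ->.
  by apply: eq_bigr => i _; rewrite sK [S (s i) i]S_C expr2.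
rewrite [X in _ + X](reindex_inj (@perm_inj _ s)) /=.
by under [X in _ + X]eq_bigr => i _ do rewrite permK S_C; rewrite addrr_pchar2.
Qed.

Lemma sqrrD_pchar2 (x y : R) : (x + y) ^+ 2 = x ^+ 2 + y ^+ 2.
Proof. by rewrite sqrrD mulr2n addrr_pchar2 // addr0. Qed.

Lemma addmx_pchar2 m n (A : 'M[R]_(m, n)) : A + A = 0.
Proof. by apply/matrixP=> i j; rewrite !mxE addrr_pchar2. Qed.

End CharTwo.

Lemma det_involutive (R : idomainType) (R2 : 2%N \in [pchar R]) n
  (J : 'M[R]_n) : J *m J = 1%:M -> \det J = 1.
Proof.
move/(congr1 (@determinant R n)); rewrite det_mulmx det1 -expr2 => /eqP.
by rewrite sqrf_eq1 oppr_pchar2 // orbb => /eqP.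
Qed.

(** The Weinstein-Aronszajn identity: two block matrices, multiplied in either order, give block
    triangular products that carry the two determinants. *)
Lemma det_1_mulmxC (R : comNzRingType) m n
    (U : 'M[R]_(m, n)) (V : 'M[R]_(n, m)) :
  \det (1%:M + U *m V) = \det (1%:M + V *m U).
Proof.
have eqB : block_mx 1%:M (- U) V 1%:M *m block_mx 1%:M U 0 1%:M =
           block_mx 1%:M 0 V (1%:M + V *m U).
  by rewrite mulmx_block !mulmx1 !mulmx0 !mul1mx !addr0 subrr addrC.
have eqC : block_mx 1%:M U 0 1%:M *m block_mx 1%:M (- U) V 1%:M =
           block_mx (1%:M + U *m V) 0 V 1%:M.
  by rewrite mulmx_block !mulmx1 !mul0mx !mul1mx !add0r addNr.
have := congr1 (@determinant R _) eqC; rewrite det_mulmx mulrC -det_mulmx eqB.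
by rewrite !det_lblock !det1 mul1r mulr1 => ->.
Qed.

(** The matrix is 1 + U V, where U selects the indices in the image of [w]; [det_1_mulmxC] brings it
    down to size r. *)
Lemma det_identity_rows (R : comNzRingType) m r (A : 'M[R]_m)
    (w : 'I_r -> 'I_m) : injective w ->
  \det (\matrix_(i, j) if i \in codom w then A i j else (i == j)%:R) =
  \det (\matrix_(a, b) A (w a) (w b)).
Proof.
move=> w_inj.
pose U := \matrix_(i < m, a < r) (i == w a)%:R : 'M[R]_(m, r).
pose V := \matrix_(a < r, j < m) (A (w a) j - (w a == j)%:R).
have ->: \matrix_(i, j) (if i \in codom w then A i j else (i == j)%:R) =
         1%:M + U *m V.
  apply/matrixP=> i j; rewrite !mxE.
  case: (boolP (i \in codom w)) => [/codomP[a ->]|wi].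
    rewrite (bigD1 a) //= big1 ?addr0 => [|b ne]; rewrite !mxE.
      by rewrite eqxx mul1r addrC subrK.
    by rewrite (inj_eq w_inj) eq_sym (negPf ne) mul0r.
  rewrite big1 ?addr0 // => b _; rewrite !mxE; case: eqP wi => [->|].
    by rewrite codom_f.
  by rewrite mul0r.
rewrite det_1_mulmxC; congr (\det _); apply/matrixP=> a b; rewrite !mxE.
rewrite (bigD1 (w b)) //= big1 => [|i ne]; rewrite !mxE.
  by rewrite eqxx mulr1 addr0 (inj_eq w_inj) addrC subrK.
by rewrite (negPf ne) mulr0.
Qed.

(** * Coefficients of determinants, and congruence modulo squares of variables *)

Section MultilinearPart.

Variables (F : fieldType) (m : nat).
Implicit Types (p q : {mpoly F[m]}) (u : 'X_{1..m}).

(** The coefficient of x^k in a x + b. *)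
Definition affine_coef (k : nat) (a b : F) : F :=
  match k with 0%N => b | 1%N => a | _ => 0 end.

Lemma mcoeff_prod_affine (a b : 'I_m -> F) u :
  (\prod_i ('X_i * (a i)%:MP + (b i)%:MP))@_u =
  \prod_i affine_coef (u i) (a i) (b i).
Proof.
pose c i (e : bool) := if e then a i else b i.
pose mon (f : {ffun 'I_m -> bool}) : 'X_{1..m} := [multinom (f i : nat) | i < m].
(* The product is expanded over the choices [f] of one summand in each factor; at most one choice
   yields the monomial u. *)
have ->: (\prod_i ('X_i * (a i)%:MP + (b i)%:MP))@_u =
    \sum_(f : {ffun 'I_m -> bool}) (\prod_i c i (f i)) * (mon f == u)%:R.
  under eq_bigr => i _.
    have ->: 'X_i * (a i)%:MP + (b i)%:MP =
        \sum_(e : bool) ((c i e)%:MP * 'X_[U_(i) *+ e]) :> {mpoly F[m]}.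
      by rewrite big_bool /= mulm1n mulm0n mpolyX0 mulr1 mulrC.
  over.
  rewrite bigA_distr_bigA raddf_sum; apply: eq_bigr => f _.
  rewrite big_split /= -rmorph_prod mprodXE mcoeffCM mcoeffX.
  congr (_ * (_ == _)%:R); apply/mnmP=> i; rewrite mnm_sumE mnmE.
  rewrite (bigD1 i) //= big1 ?addn0 => [|j ne]; rewrite mulmnE mnm1E.
    by rewrite eqxx mul1n.
  by rewrite (negPf ne).
case: (boolP [forall i, (u i <= 1)%N]) => [/forallP u1|].
  rewrite (bigD1 [ffun i => u i == 1%N]) //= [X in _ + X]big1 ?addr0 => [|f ne].
    have ->: mon [ffun i => u i == 1%N] == u.
      by apply/eqP/mnmP=> i; rewrite mnmE ffunE; case: (u i) (u1 i) => [|[]].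
    rewrite mulr1; apply: eq_bigr => i _; rewrite ffunE /c.
    by case: (u i) (u1 i) => [|[]].
  case: eqP => [eqf|]; last by rewrite mulr0.
  by case/eqP: ne; apply/ffunP=> i; rewrite ffunE -eqf mnmE; case: (f i).
rewrite negb_forall => /existsP[i ui].
rewrite [RHS](bigD1 i) //= big1 => [|f _].
  by case: (u i) ui => [|[|k]] //= _; rewrite mul0r.
case: eqP => [eqf|]; last by rewrite mulr0.
by move: ui; rewrite -eqf mnmE; case: (f i).
Qed.

(** Each variable lives in a single row, so in every term of the Leibniz expansion the coefficient
    of x^u is taken row by row. *)
Lemma mcoeff_det_affine k (C : 'M[F]_(k, k + m)) (a b : 'M[F]_(m, k + m)) u :
  (\det (col_mx (map_mx (@mpolyC m F) C)
      (\matrix_(i, j) ('X_i * (a i j)%:MP + (b i j)%:MP))))@_u =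
  \det (col_mx C (\matrix_(i, j) affine_coef (u i) (a i j) (b i j))).
Proof.
rewrite /determinant raddf_sum; apply: eq_bigr => s _ /=.
rewrite !big_split_ord /=.
under eq_bigr => i _ do rewrite col_mxEu mxE.
under [X in _ * (_ * X)]eq_bigr => i _ do rewrite col_mxEd mxE.
rewrite -rmorph_prod -(rmorph_sign (@mpolyC m F)) !mcoeffCM mcoeff_prod_affine.
congr (_ * (_ * _)); apply: eq_bigr => i _; first by rewrite col_mxEu.
by rewrite col_mxEd mxE.
Qed.

Lemma mcoeff_det_affine0 (a b : 'M[F]_m) u :
  (\det (\matrix_(i, j) ('X_i * (a i j)%:MP + (b i j)%:MP)))@_u =
  \det (\matrix_(i, j) affine_coef (u i) (a i j) (b i j)).
Proof.
have E (R : Type) (A : 'M[R]_m) (C : 'M[R]_(0, 0 + m)) : A = col_mx C A.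
  apply/matrixP=> i j; have ei : i = rshift 0 i by apply: val_inj.
  by rewrite -[LHS](col_mxEd C A) -ei.
by have := mcoeff_det_affine (0 : 'M_(0, 0 + m)) a b u; rewrite -!E.
Qed.

Lemma mpoly_pchar2 : 2%N \in [pchar F] -> 2%N \in [pchar {mpoly F[m]}].
Proof.
move=> F2; rewrite inE /= -(rmorph_nat (@mpolyC m F)).
by rewrite (pcharf0 F2) rmorph0.
Qed.

(* Congruence modulo the ideal generated by the squares of the variables. *)
Definition eq_mlin p q := forall u, (forall i, u i <= 1)%N -> p@_u = q@_u.

Lemma eq_mlinD p q p' q' :
  eq_mlin p q -> eq_mlin p' q' -> eq_mlin (p + p') (q + q').
Proof. by move=> e e' u u1; rewrite !mcoeffD e ?e'. Qed.

Lemma eq_mlinM p q p' q' :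
  eq_mlin p q -> eq_mlin p' q' -> eq_mlin (p * p') (q * q').
Proof.
move=> e e' u u1; rewrite !mcoeffM; apply: eq_bigr => -[v w] /eqP /= eqvw.
have u_i i : u i = (v i + w i)%N by rewrite {1}eqvw mnmDE.
by rewrite e ?e' // => i; apply: leq_trans (u1 i); rewrite u_i ?leq_addl ?leq_addr.
Qed.

Lemma eq_mlin_sqrX (i : 'I_m) : eq_mlin ('X_i ^+ 2) 0.
Proof.
move=> u u1; rewrite mcoeffXn mcoeff0; case: eqP => // eqx.
by move: (u1 i); rewrite -eqx mulmnE mnm1E eqxx.
Qed.

(** By [det_sym_pchar2] the off-diagonal entries enter only through their squares, and [eq_mlin] is
    compatible with sums and products. *)
Lemma eq_mlin_det (F2 : 2%N \in [pchar F]) n (S S' : 'M[{mpoly F[m]}]_n) :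
  S^T = S -> S'^T = S' -> (forall i, S i i = S' i i) ->
  (forall i j, i != j -> eq_mlin (S i j ^+ 2) (S' i j ^+ 2)) ->
  eq_mlin (\det S) (\det S').
Proof.
move=> sym sym' dg offdg.
have R2 := mpoly_pchar2 F2.
rewrite !det_sym_pchar2 //.
apply: (big_ind2 eq_mlin) => // [p q p' q'|s _]; first exact: eq_mlinD.
apply: eq_mlinM; first by move=> u _; congr (_@_u); apply: eq_bigr.
apply: (big_ind2 eq_mlin) => // [p q p' q'|i lti]; first exact: eq_mlinM.
by apply: offdg; apply: contraTneq lti => <-; rewrite ltnn.
Qed.

End MultilinearPart.

(** * Symmetric determinantal representations *)

Section Representation.

Variable F : fieldType.
Hypothesis F2 : 2%N \in [pchar F].

(** A form of the principal pivot transform. The last two equations say that p stacked on q solves a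
    linear system with matrix (G, e^T; sg e, tau) and right-hand side (0; 1). The matrix A inherits
    its symmetry from (e p)^T q = - p^T G p. *)
Lemma complementary_pivot m k (tau sg : 'M[F]_m) (G : 'M[F]_k)
    (e : 'M[F]_(m, k)) (p : 'M[F]_(k, m)) (q : 'M[F]_m) :
  tau *m tau = tau -> sg *m sg = sg -> tau *m sg = 0 -> sg *m tau = 0 ->
  tau + sg = 1%:M -> tau^T = tau -> sg^T = sg -> G^T = G ->
  G *m p + e^T *m q = 0 -> sg *m e *m p + tau *m q = 1%:M ->
  exists A : 'M[F]_m,
    [/\ A^T = A, e *m p = tau *m A + sg & q = sg *m A + tau].
Proof.
move=> tauK sgK tausg sgtau tsD tauT sgT symG eq1 eq2.
have [A [tauA sgA]] : exists A, tau *m A = tau *m (e *m p) /\ sg *m A = sg *m q.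
  exists (tau *m (e *m p) + sg *m q); rewrite !mulmxDr !mulmxA tauK tausg sgK.
  by rewrite sgtau !mul0mx addr0 add0r.
have epE : e *m p = tau *m A + sg.
  rewrite tauA -[sg in RHS]mulmx1 -eq2 mulmxDr !mulmxA sgK sgtau mul0mx addr0.
  by rewrite -!mulmxA -mulmxDl tsD mul1mx.
have qE : q = sg *m A + tau.
  rewrite sgA -[tau in RHS]mulmx1 -eq2 mulmxDr !mulmxA tausg tauK !mul0mx add0r.
  by rewrite -mulmxDl addrC tsD mul1mx.
exists A; split=> //.
have: ((e *m p)^T *m q)^T = (e *m p)^T *m q.
  have -> : (e *m p)^T *m q = - (p^T *m G *m p).
    rewrite trmx_mul -!mulmxA -mulmxN; congr (_ *m _).
    by apply/eqP; rewrite -addr_eq0 addrC eq1.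
  by rewrite linearN /= !trmx_mul trmxK symG mulmxA.
have -> : (e *m p)^T *m q = A^T *m tau + sg *m A.
  rewrite epE qE [(_ + _)^T]linearD /= trmx_mul tauT sgT mulmxDl !mulmxDr.
  rewrite !mulmxA -!(mulmxA A^T) tausg tauK sgK sgtau !(mul0mx, mulmx0).
  by rewrite !(addr0, add0r) addrC.
(* With sg = 1 + tau, the symmetry of A^T tau + sg A reduces to A^T = A once the common terms
   cancel. *)
have sgE : sg = 1%:M + tau.
  by rewrite -tsD addrC addrA addmx_pchar2 // add0r.
rewrite [(_ + _)^T]linearD /= !trmx_mul trmxK tauT sgT sgE.
rewrite mulmxDr mulmxDl mulmx1 mul1mx.
rewrite [in RHS]addrA [in RHS]addrC => eqA.
apply: (addrI (A^T *m tau)); apply: (addrI (tau *m A)).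
by rewrite -eqA [A^T + _]addrC.
Qed.

Variable m : nat.

Local Notation "A ^%" := (map_mx (@mpolyC m F) A) (at level 2, format "A ^%").
Local Notation X := (diag_mx (\row_(i < m) 'X_i) : 'M[{mpoly F[m]}]_m).

Let R2 : 2%N \in [pchar {mpoly F[m]}] := mpoly_pchar2 m F2.

(* Row i is A_i + x_i e_i if T i, and x_i A_i + e_i otherwise: the coefficient of
   x^U in the determinant is the principal minor of A on the symmetric difference
   of U and T. *)
Definition pivot_mx (T : 'I_m -> bool) (A : 'M[F]_m) : 'M[{mpoly F[m]}]_m :=
  \matrix_(i, j) ('X_i * (if T i then (i == j)%:R else A i j)%:MP +
                  (if T i then A i j else (i == j)%:R)%:MP).

Lemma mcoeff_det_pivot T A (u : 'X_{1..m}) : (forall i, u i <= 1)%N ->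
  (\det (pivot_mx T A))@_u =
  \det (\matrix_(i, j) if T i (+) (u i == 1%N) then A i j else (i == j)%:R).
Proof.
move=> u1.
pose a : 'M[F]_m := \matrix_(i, j) (if T i then (i == j)%:R else A i j).
pose b : 'M[F]_m := \matrix_(i, j) (if T i then A i j else (i == j)%:R).
have ->: pivot_mx T A = \matrix_(i, j) ('X_i * (a i j)%:MP + (b i j)%:MP).
  by apply/matrixP=> i j; rewrite !mxE.
rewrite mcoeff_det_affine0; congr (\det _); apply/matrixP=> i j; rewrite !mxE.
by case: (u i) (u1 i) => [|[]] // _ /=; case: (T i).
Qed.

Lemma pivot_mxE (T : 'I_m -> bool) A :
  let tau := diag_mx (\row_i (T i)%:R) : 'M[F]_m in
  pivot_mx T A = (tau *m A + (1%:M - tau))^% + X *m ((1%:M - tau) *m A + tau)^%.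
Proof.
move=> tau; apply/matrixP=> i j; rewrite mulmxBl mul1mx !mul_diag_mx !mxE addrC.
by case: (T i); rewrite ?mulr1n ?mul1r ?mul0r ?mul0rn ?subrr ?addr0 ?subr0 ?add0r.
Qed.

(** Brings the bordered matrix into the form of [mcoeff_det_affine]: constant rows on top, then one
    row for each variable. *)
Lemma bordered_mxE k (G : 'M[F]_k) (e : 'M[F]_(m, k)) :
  block_mx G^% (e^T)^% e^% X =
  col_mx (row_mx G e^T)^% (\matrix_(i, j) ('X_i * (row_mx 0 1%:M i j)%:MP +
                                            (row_mx e 0 i j)%:MP)).
Proof.
rewrite /block_mx map_row_mx; congr col_mx.
apply/matrixP=> i j; rewrite [RHS]mxE.
case: (splitP j) => j' ej.
  have ->: j = lshift m j' by apply: val_inj.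
  by rewrite !row_mxEl !mxE mpolyC0 mulr0 add0r.
have ->: j = rshift k j' by apply: val_inj.
rewrite !row_mxEr !mxE mpolyC0 addr0.
by case: (i == j'); rewrite ?mulr1n ?mulr0n ?mpolyC0 ?mpolyC1 ?mulr1 ?mulr0.
Qed.

Lemma mcoeff_det_bordered0 k (G : 'M[F]_k) (e : 'M[F]_(m, k)) (u : 'X_{1..m})
    (i : 'I_m) : (1 < u i)%N -> (\det (block_mx G^% (e^T)^% e^% X))@_u = 0.
Proof.
move=> ui; rewrite bordered_mxE mcoeff_det_affine.
rewrite (expand_det_row _ (rshift k i)) big1 // => j _.
by rewrite col_mxEd mxE; case: (u i) ui => [|[|n]] //= _; rewrite mul0r.
Qed.

(** Multiplication by the inverse of a constant matrix [K] of determinant P@_T turns the top rows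
    into (1 0); the block that remains is [pivot_mx]. *)
Lemma det_bordered_pivot k (G : 'M[F]_k) (e : 'M[F]_(m, k)) (T : 'X_{1..m}) :
  let P := \det (block_mx G^% (e^T)^% e^% X) in
  G^T = G -> (forall i, T i <= 1)%N -> P@_T != 0 ->
  exists2 A : 'M[F]_m, A^T = A &
    P = (P@_T)%:MP * \det (pivot_mx (fun i => T i == 1%N) A).
Proof.
move=> P symG T1 PT0.
pose t : 'I_m -> bool := fun i => T i == 1%N.
pose tau := diag_mx (\row_i (t i)%:R) : 'M[F]_m.
pose top := row_mx G e^T.
pose K := col_mx top (row_mx ((1%:M - tau) *m e) tau).
have tauK : tau *m tau = tau.
  by apply/matrixP=> i j; rewrite mul_diag_mx !mxE; case: (t i); rewrite ?mul1r ?mul0r ?mul0rn.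
have tauV : tau *m (1%:M - tau) = 0 by rewrite mulmxBr mulmx1 tauK subrr.
have tauW : (1%:M - tau) *m tau = 0 by rewrite mulmxBl mul1mx tauK subrr.
have tauT : tau^T = tau by rewrite tr_diag_mx.
have detK : \det K = P@_T.
  rewrite /P bordered_mxE mcoeff_det_affine; congr (\det (col_mx _ _)).
  apply/matrixP=> i j; rewrite [RHS]mxE.
  case: (splitP j) => j' ej.
    have ->: j = lshift m j' by apply: val_inj.
    rewrite !row_mxEl mulmxBl mul1mx mul_diag_mx !mxE /t.
    by case: (T i) (T1 i) => [|[]] //= _; rewrite ?mul0r ?subr0 // mul1r subrr.
  have ->: j = rshift k j' by apply: val_inj.
  rewrite !row_mxEr !mxE /t.
  by case: (T i) (T1 i) => [|[]] //= _; rewrite ?mul0rn.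
have Ku : K \in unitmx by rewrite unitmxE detK unitfE.
pose V := rsubmx (invmx K).
pose p := usubmx V; pose q := dsubmx V.
have KV : K *m V = col_mx 0 1%:M.
  by rewrite mulmx_rsub mulmxV // scalar_mx_block block_mxEh row_mxKr.
move: (KV); rewrite -[V]vsubmxK -/p -/q mul_col_mx !mul_row_col.
case/eq_col_mx => eq1 eq2.
have [|||A [symA epE qE]] := complementary_pivot tauK _ tauV tauW _ tauT _ symG eq1 eq2.
- by rewrite mulmxBl mul1mx tauV subr0.
- by rewrite addrC subrK.
- by rewrite linearB /= tauT tr_scalar_mx.
exists A => //.
pose S := block_mx G^% (e^T)^% e^% X.
have SK : \det (S *m (invmx K)^%) = \det (pivot_mx t A).
  have topK : top *m invmx K = row_mx 1%:M 0.
    have := mulmxV Ku; rewrite mul_col_mx scalar_mx_block.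
    by case/eq_col_mx.
  rewrite /S /block_mx -map_row_mx -/top mul_col_mx -map_mxM topK.
  rewrite -[X in col_mx _ X]hsubmxK map_row_mx map_mx1 map_mx0.
  rewrite -/(block_mx _ _ _ _) det_lblock det1 mul1r -mulmx_rsub -map_rsubmx -/V.
  rewrite -[V]vsubmxK -/p -/q map_col_mx mul_row_col -map_mxM epE qE.
  by rewrite pivot_mxE.
rewrite -SK det_mulmx -/P mulrC -mulrA det_map_mx -rmorphM -detK -det_mulmx.
by rewrite mulVmx // det1 mulr1.
Qed.

(* Right to left, it moves each variable to a single diagonal position. *)
Lemma det_bordered_compress n (B : 'M[F]_n) (E : 'M[F]_(n, m)) :
  let G := block_mx B E E^T 0 in
  let e : 'M[F]_(m, n + m) := row_mx 0 1%:M in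
  \det (block_mx G^% (e^T)^% e^% X) = \det (B^% + E^% *m X *m (E^%)^T).
Proof.
move=> G e.
pose E' := E^%.
(* The column operations [Q] and the row operation [L] have determinant 1. They make the matrix
   block upper triangular, with diagonal blocks B + E X E^T, 1 and 1. *)
pose Q := block_mx (block_mx 1%:M 0 (X *m E'^T) 1%:M) 0
            (row_mx E'^T 1%:M) 1%:M : 'M[{mpoly F[m]}]_(n + m + m).
pose L := block_mx 1%:M 0 (row_mx 0 (1%:M + X)) 1%:M
  : 'M[{mpoly F[m]}]_(n + m + m).
have detQ : \det Q = 1 by rewrite det_lblock !det1 mulr1 det_lblock !det1 mulr1.
have detL : \det L = 1 by rewrite det_lblock !det1 mulr1.
rewrite /G /e tr_row_mx trmx0 trmx1 !map_block_mx map_row_mx map_col_mx.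
rewrite !map_mx0 !map_mx1 -map_trmx -/E'; set B' := B^%.
have SQ : block_mx (block_mx B' E' E'^T 0) (col_mx 0 1%:M) (row_mx 0 1%:M) X *m Q =
    block_mx (block_mx (B' + E' *m X *m E'^T) E' 0 1%:M) (col_mx 0 1%:M)
      (row_mx 0 (1%:M + X)) X.
  rewrite /Q mulmx_block; congr block_mx.
  - rewrite mulmx_block mul_col_row !mulmx0 !mulmx1 !mul0mx !mul1mx !addr0 !add0r.
    by rewrite add_block_mx !addr0 !add0r (addmx_pchar2 R2) mulmxA.
  - by rewrite mulmx0 mulmx1 add0r.
  - rewrite mul_row_block mul_mx_row !mul0mx !mul1mx !add0r mulmx1 add_row_mx.
    by rewrite (addmx_pchar2 R2).
  - by rewrite mulmx0 mulmx1 add0r.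
have LSQ : L *m block_mx (block_mx (B' + E' *m X *m E'^T) E' 0 1%:M)
      (col_mx 0 1%:M) (row_mx 0 (1%:M + X)) X =
    block_mx (block_mx (B' + E' *m X *m E'^T) E' 0 1%:M) (col_mx 0 1%:M) 0 1%:M.
  rewrite /L mulmx_block !mul1mx !mul0mx !addr0; congr block_mx.
  - by rewrite mul_row_block !mul0mx !mulmx0 mulmx1 !add0r (addmx_pchar2 R2).
  - by rewrite mul_row_col mul0mx mulmx1 add0r -addrA (addmx_pchar2 R2) addr0.
transitivity (\det (L *m (block_mx (block_mx B' E' E'^T 0) (col_mx 0 1%:M)
    (row_mx 0 1%:M) X *m Q))); first by rewrite !det_mulmx detL detQ mul1r mulr1.
rewrite SQ LSQ.
by rewrite det_ublock det1 mulr1 det_ublock det1 mulr1.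
Qed.

Lemma det_pivot_coef (T : 'I_m -> bool) (A : 'M[F]_m) (u : 'X_{1..m}) r
    (w : 'I_r -> 'I_m) : injective w -> (forall i, u i <= 1)%N ->
    (forall i, T i (+) (u i == 1%N) = (i \in codom w)) ->
  (\det (pivot_mx T A))@_u = \det (\matrix_(a, b) A (w a) (w b)).
Proof.
move=> w_inj u1 eqw; rewrite mcoeff_det_pivot // -det_identity_rows //.
by congr (\det _); apply/matrixP=> i j; rewrite !mxE eqw.
Qed.

Lemma det_mx22_sym (A : 'M[F]_m) (i j : 'I_m) : A^T = A -> i != j ->
  \det (\matrix_(a < 2, b < 2) A (if a == 0 then i else j) (if b == 0 then i else j)) =
  A i i * A j j + A i j ^+ 2.
Proof.
move=> symA ij; rewrite (expand_det_row _ 0) !big_ord_recl big_ord0 addr0.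
rewrite !mxE /= /cofactor !det_mx11 !mxE /= mul1r expr1 mulN1r.
have -> : A j i = A i j by rewrite -{1}symA mxE.
by rewrite oppr_pchar2 // expr2.
Qed.

(** Column operations [Q] and row operations [L1], [L2], all of determinant 1, lead to a block
    triangular matrix. Its diagonal blocks are [W], the transpose of [pivot_mx], and the involutive
    block (s, t; t, s), of determinant 1. *)
Lemma det_gadget (T : 'I_m -> bool) (A : 'M[F]_m) : A^T = A ->
  let tau := diag_mx (\row_i (T i)%:R) : 'M[F]_m in
  \det (block_mx X (row_mx (1%:M - tau) tau)^%
     (col_mx (1%:M - tau) tau)^% (block_mx A tau tau (1%:M - tau))^%) =
  \det (pivot_mx T A).
Proof.
move=> symA tau; pose sg := 1%:M - tau.
pose t := tau^%; pose s := sg^%; pose A' := A^%.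
pose Y := t + s *m X; pose W := A' *m Y + t *m X + s.
have tK : t *m t = t.
  rewrite -map_mxM; congr (_^%); apply/matrixP=> i j; rewrite mul_diag_mx !mxE.
  by case: (T i); rewrite ?mul1r ?mul0r ?mul0rn.
have tsD : t + s = 1%:M by rewrite -map_mxD addrC subrK map_mx1.
have ts : t *m s = 0.
  by rewrite -[s]add0r -(addmx_pchar2 R2 t) -addrA tsD mulmxDr tK mulmx1 (addmx_pchar2 R2).
have st : s *m t = 0.
  by rewrite -[s]add0r -(addmx_pchar2 R2 t) -addrA tsD mulmxDl tK mul1mx (addmx_pchar2 R2).
have sK : s *m s = s.
  by rewrite -{3}[s]mulmx1 -tsD mulmxDr st add0r.
pose H := block_mx A' t t s.
pose Q := block_mx 1%:M 0 (col_mx Y (t *m X)) 1%:M : 'M[{mpoly F[m]}]_(m + (m + m)).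
pose L1 := block_mx 1%:M (row_mx 1%:M 0) 0 1%:M : 'M[{mpoly F[m]}]_(m + (m + m)).
pose L2 := block_mx 1%:M 0 (col_mx 1%:M 0) 1%:M : 'M[{mpoly F[m]}]_(m + (m + m)).
have dQ : \det Q = 1 by rewrite det_lblock !det1 mulr1.
have dL1 : \det L1 = 1 by rewrite det_ublock !det1 mulr1.
have dL2 : \det L2 = 1 by rewrite det_lblock !det1 mulr1.
have SQ : block_mx X (row_mx s t) (col_mx s t) H *m Q =
    block_mx 0 (row_mx s t) (col_mx W 0) H.
  rewrite /Q mulmx_block !mulmx0 !mulmx1 !add0r; congr block_mx.
  - rewrite mul_row_col /Y mulmxDr !mulmxA st sK tK add0r -mulmxDl addrC.
    by rewrite -[s + t]addrC tsD mul1mx (addmx_pchar2 R2).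
  - rewrite mul_block_col add_col_mx; congr col_mx.
      by rewrite !mulmxA tK addrC.
    rewrite mulmxDr !mulmxA tK ts st !mul0mx !addr0.
    by rewrite (addmx_pchar2 R2).
have LSQ : L1 *m block_mx 0 (row_mx s t) (col_mx W 0) H =
    block_mx W (row_mx (s + A') 0) (col_mx W 0) H.
  rewrite /L1 mulmx_block !mul1mx !mul0mx !add0r; congr block_mx.
    by rewrite mul_row_col mul1mx mul0mx addr0.
  by rewrite mul_row_block !mul1mx !mul0mx !addr0 add_row_mx (addmx_pchar2 R2).
have LLSQ : L2 *m block_mx W (row_mx (s + A') 0) (col_mx W 0) H =
    block_mx W (row_mx (s + A') 0) 0 (block_mx s t t s).
  rewrite /L2 mulmx_block !mul1mx !mul0mx !addr0; congr block_mx.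
    by rewrite mul_col_mx mul1mx mul0mx add_col_mx (addmx_pchar2 R2) addr0 col_mx0.
  rewrite mul_col_row !mul1mx !mul0mx add_block_mx !add0r.
  by rewrite -addrA (addmx_pchar2 R2) addr0.
transitivity (\det (L2 *m (L1 *m (block_mx X (row_mx s t) (col_mx s t) H *m Q)))).
  rewrite !det_mulmx dL1 dL2 dQ !mul1r mulr1.
  by rewrite map_row_mx map_col_mx map_block_mx.
rewrite SQ LSQ LLSQ det_ublock (@det_involutive _ _ _ (block_mx s t t s)) //; last first.
  by rewrite mulmx_block sK tK st ts addr0 [s + t]addrC tsD -scalar_mx_block.
rewrite mulr1 -det_tr; congr (\det _).
have tT : t^T = t by rewrite map_trmx tr_diag_mx.
have sT : s^T = s by rewrite map_trmx linearB /= trmx1 tr_diag_mx.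
have A'T : A'^T = A' by rewrite map_trmx symA.
have -> : pivot_mx T A = t *m A' + s + X *m (s *m A' + t).
  by rewrite pivot_mxE -/tau -/sg (map_mxD _ (tau *m A)) (map_mxD _ (sg *m A)) !map_mxM.
have tr_W (D t' s' B : 'M[{mpoly F[m]}]_m) :
    D^T = D -> t'^T = t' -> s'^T = s' -> B^T = B ->
    (B *m (t' + s' *m D) + t' *m D + s')^T = t' *m B + s' + D *m (s' *m B + t').
  move=> DT tT' sT' BT; rewrite !(raddfD (@trmx _ m m)) /= !trmx_mul.
  rewrite !(raddfD (@trmx _ m m)) /= !trmx_mul DT tT' sT' BT mulmxDl mulmxDr.
  by rewrite mulmxA -!addrA; congr (_ + _); rewrite addrA addrC.
by apply: tr_W; rewrite ?tr_diag_mx.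
Qed.

End Representation.

(** * Recovering the matrix from the coefficients *)

Section SDR.

Variable F : finFieldType.
Hypothesis F2 : 2%N \in [pchar F].
Variable m : nat.
Implicit Types (P : {mpoly F[m]}) (T : 'X_{1..m}).

Local Notation "A ^%" := (map_mx (@mpolyC m F) A) (at level 2, format "A ^%").
Local Notation X := (diag_mx (\row_(i < m) 'X_i) : 'M[{mpoly F[m]}]_m).

(** Modulo squares of variables, M may be replaced by B + E X E^T: the diagonals agree, and the
    off-diagonal variables, present in either matrix, have squares congruent to 0. After
    [det_bordered_compress] both sides are multilinear, so the congruence is an equality. *)
Lemma SDR_bordered P n (M : 'M[entry F m]_n) :
  multilinear P -> is_SDR P M ->
  exists k (G : 'M[F]_k) (e : 'M[F]_(m, k)),
    G^T = G /\ P = \det (block_mx G^% (e^T)^% e^% X).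
Proof.
move=> mlP [_ symM detM].
have R2 := mpoly_pchar2 m F2.
have M_C i j : M i j = M j i by rewrite -{1}symM mxE.
pose B := \matrix_(i, j) (if M i j is inl a then a else 0) : 'M[F]_n.
pose E := \matrix_(i, v) (M i i == inr v)%:R : 'M[F]_(n, m).
exists (n + m)%N, (block_mx B E E^T 0), (row_mx 0 1%:M).
have symB : B^T = B by apply/matrixP=> i j; rewrite !mxE M_C.
split; first by rewrite tr_block_mx symB trmxK trmx0.
(* If two diagonal entries of M are the same x_v, the product also has x_v at the two off-diagonal
   positions that join them. *)
have EXE i j : (E^% *m X *m (E^%)^T) i j =
    if M i i is inr v then (M j j == inr v)%:R * 'X_v else 0.
  rewrite mul_mx_diag mxE.
  have Eij v : (\matrix_(i0, j0) (E^% i0 j0 * (\row_i1 'X_i1) 0 j0)) i v * (E^%)^T v j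
      = (M i i == inr v)%:R * ((M j j == inr v)%:R * 'X_v) :> {mpoly F[m]}.
    by rewrite !mxE !rmorph_nat mulrAC -mulrA.
  under eq_bigr => v _ do rewrite Eij.
  case: (M i i) => [a|v]; first by rewrite big1 // => v _; rewrite mul0r.
  rewrite (bigD1 v) //= eqxx mul1r big1 ?addr0 // => w ne.
  by rewrite (inj_eq inr_inj) eq_sym (negPf ne) mul0r.
have PE : eq_mlin P (\det (B^% + E^% *m X *m (E^%)^T)).
  rewrite -detM; apply: eq_mlin_det => //.
  - by rewrite map_trmx symM.
  - rewrite (raddfD (@trmx _ n n)) /= [(B^%)^T]map_trmx symB; congr (_ + _).
    by rewrite !trmx_mul trmxK tr_diag_mx mulmxA.
  - move=> i; rewrite mxE [RHS]mxE EXE [B^% i i]mxE [B i i]mxE.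
    by case: (M i i) => [a|v] /=; rewrite ?addr0 // eqxx mpolyC0 mul1r add0r.
  move=> i j ne; rewrite [(map_mx _ M) i j]mxE [fun_of_matrix (_ + _) i j]mxE EXE.
  rewrite sqrrD_pchar2 // [B^% i j]mxE [B i j]mxE.
  have sq0 : eq_mlin (0 : {mpoly F[m]}) ((if M i i is inr v then (M j j == inr v)%:R * 'X_v else 0) ^+ 2).
    case: (M i i) => [a|v] /=; first by rewrite expr0n.
    case: eqP => _; last by rewrite mul0r expr0n.
    by rewrite mul1r => u u1; rewrite eq_mlin_sqrX.
  rewrite -[X in eq_mlin X _]addr0; apply: eq_mlinD => //.
  case: (M i j) => [a|v] //=.
  by rewrite mpolyC0 expr0n; apply: eq_mlin_sqrX.
rewrite -det_bordered_compress // in PE.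
apply/mpolyP=> u; case: (boolP [forall i, (u i <= 1)%N]) => [/forallP|].
  exact: PE.
rewrite negb_forall => /existsP[i]; rewrite -ltnNge => ui.
rewrite (mcoeff_det_bordered0 _ _ ui); apply/eqP; rewrite -[_ == 0]negbK -mcoeff_msupp.
by apply: contraL ui => /mlP; rewrite -leqNgt.
Qed.

Definition sqrtF (y : F) : F := odflt 0 [pick x | x ^+ 2 == y].

(** In characteristic 2 a square has only one root, so the root that is picked must be x. *)
Lemma sqrtF_sqr (x : F) : sqrtF (x ^+ 2) = x.
Proof.
rewrite /sqrtF; case: pickP => [y|/(_ x)]; last by rewrite eqxx.
by rewrite eqf_sqr oppr_pchar2 // orbb => /eqP.
Qed.

(** On exponents at most 1, the symmetric difference with {i}. *)
Definition flip (i : 'I_m) T : 'X_{1..m} :=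
  [multinom if j == i then (1 - T j)%N else T j | j < m].

(** Solves for A the equations given by its minors of size 1 and 2: the coefficient ratios are A_ii
    for one flip and A_ii A_jj + A_ij^2 for two, and adding a_i a_j isolates A_ij^2 in
    characteristic 2. *)
Definition SDR_core P T : 'M[F]_m :=
  let a i := P@_(flip i T) / P@_T in
  \matrix_(i, j) if i == j then a i
                 else sqrtF (a i * a j + P@_(flip i (flip j T)) / P@_T).

Lemma SDR_core_sym P T : (SDR_core P T)^T = SDR_core P T.
Proof.
apply/matrixP=> i j; rewrite !mxE eq_sym; case: eqVneq => [->//|ne].
suff -> : flip i (flip j T) = flip j (flip i T) by rewrite [_ / _ * _]mulrC.
apply/mnmP=> k; rewrite !mnmE.
by case: (eqVneq k i) => // ->; case: (eqVneq i j) ne => // ->.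
Qed.

(** If P@_T is nonzero, [det_bordered_pivot] gives some symmetric A, and the minors of size 1 and 2
    force it to be [SDR_core]. Otherwise P = 0 and both sides vanish. *)
Lemma SDR_core_det P T n (M : 'M[entry F m]_n) :
  multilinear P -> is_SDR P M -> (forall i, T i <= 1)%N ->
  (P@_T = 0 -> P = 0) ->
  P = (P@_T)%:MP * \det (pivot_mx (fun i => T i == 1%N) (SDR_core P T)).
Proof.
move=> mlP sdrM T1; case: (eqVneq P@_T 0) => [T0 /(_ T0)|T0 _].
  by move=> P0; rewrite T0 mpolyC0 mul0r.
have [k [G [e [symG PE]]]] := SDR_bordered mlP sdrM.
have T0' := T0; rewrite PE in T0'.
have [A symA] := det_bordered_pivot F2 symG T1 T0'; rewrite -PE => PA.
suff -> : SDR_core P T = A by [].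
pose t i := T i == 1%N.
have flip1 i (u : 'X_{1..m}) : (forall j, u j <= 1)%N -> (forall j, flip i u j <= 1)%N.
  by move=> u1 j; rewrite mnmE; case: eqP => // _; apply: leq_subr.
have tflip i (u : 'X_{1..m}) j : (forall j, u j <= 1)%N ->
    (flip i u j == 1%N) = (j == i) (+) (u j == 1%N).
  by move=> u1; rewrite mnmE; case: (j == i) => //; case: (u j) (u1 j) => [|[]].
have coefP r (w : 'I_r -> 'I_m) (u : 'X_{1..m}) : injective w -> (forall i, u i <= 1)%N ->
    (forall i, t i (+) (u i == 1%N) = (i \in codom w)) ->
    P@_u / P@_T = \det (\matrix_(a, b) A (w a) (w b)).
  move=> w_inj u1 eqw; rewrite {1}PA mcoeffCM mulrC mulKf //.
  exact: det_pivot_coef.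
have coef1 i : P@_(flip i T) / P@_T = A i i.
  rewrite (coefP 1%N (fun=> i)) ?det_mx11 ?mxE //; last 1 first.
  - move=> j; rewrite tflip // addbCA addbb addbF.
    by apply/eqP/codomP => [->|[]//]; exists 0.
  - by move=> a b _; rewrite [a]ord1 [b]ord1.
  - exact: flip1.
apply/matrixP=> i j; rewrite mxE; case: eqVneq => [->|ne]; first exact: coef1.
rewrite !coef1 (coefP 2%N (fun a => if a == 0 then i else j)).
- by rewrite (det_mx22_sym F2) // addrA addrr_pchar2 // add0r sqrtF_sqr.
- move=> a b; case: (eqVneq a 0) => [->|a0]; case: (eqVneq b 0) => [->|b0] // eij.
  + by move: ne; rewrite eij eqxx.
  + by move: ne; rewrite eij eqxx.
  + by apply: val_inj; case: a b a0 b0 {eij} => [[|[|a]] //= ?] [[|[|b]] //= ?].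
- by apply/flip1/flip1.
move=> h; rewrite !tflip //; last exact: flip1.
rewrite [t h]/t addbC -!addbA addbb addbF.
apply/idP/codomP => [|[a ->]].
  case: (eqVneq h i) => [-> _|_]; first by exists 0.
  by case: (eqVneq h j) => [->|] // _; exists 1.
case: (a == 0); first by rewrite eqxx (negPf ne).
by rewrite eqxx eq_sym (negPf ne).
Qed.

End SDR.

(** * The symmetric matrix that is returned *)

Section Gadget.

Variable F : finFieldType.
Hypothesis F2 : 2%N \in [pchar F].
Variables (m : nat) (T : 'I_m -> bool) (A : 'M[F]_m) (c : F).

(* Row [None] is the 1 x 1 block c; rows [Some (0, i)], [Some (1, i)] and
   [Some (2, i)] are the blocks X, A and 1 - tau of [det_gadget]. *)
Definition label : Type := option (nat * 'I_m).

Definition labels : seq label :=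
  None :: [seq Some (0%N, i) | i <- enum 'I_m] ++
          ([seq Some (1%N, i) | i <- enum 'I_m] ++
           [seq Some (2%N, i) | i <- enum 'I_m]).

(** Codes for the blocks of [det_gadget]: 0 for A, 1 for X, 2 for 1 - tau, 3 for tau. As a table it
    can be looked up by a program. *)
Definition label_op (t t' : nat) : nat :=
  nth 0%N (nth [::] [:: [:: 1; 2; 3]; [:: 2; 0; 3]; [:: 3; 3; 2]] t)%N t'.

Definition gadget_entry (d d' : label) : entry F m :=
  match d, d' with
  | None, None => inl c
  | Some (t, i), Some (t', j) =>
    match label_op t t' with
    | 0%N => inl (A i j)
    | k => if i != j then inl 0 else
           match k with
           | 1%N => inr i
           | 2%N => inl (~~ T i)%:R
           | _ => inl (T i)%:R
           end
    end
  | _, _ => inl 0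
  end.

Definition gadget : 'M[entry F m]_(1 + (m + (m + m))) :=
  \matrix_(i, j) gadget_entry (nth None labels i) (nth None labels j).

Lemma size_labels : size labels = (1 + (m + (m + m)))%N.
Proof. by rewrite /labels -cat1s !size_cat !(size_enum_ord, size_map). Qed.

Let nth_block (t : nat) (i : 'I_m) (s : seq label) :
  nth None ([seq Some (t, j) | j <- enum 'I_m] ++ s) i = Some (t, i).
Proof.
rewrite nth_cat size_map size_enum_ord ltn_ord (nth_map i) ?size_enum_ord //.
by rewrite nth_ord_enum.
Qed.

Let labels_rshift (n : nat) (t : nat) (i : 'I_n) (s : seq label) :
  nth None ([seq Some (t, j) | j <- enum 'I_m] ++ s) (m + i) = nth None s i.
Proof. by rewrite nth_cat size_map size_enum_ord ltnNge leq_addr addKn. Qed.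

Let label0 (i : 'I_1) : nth None labels (lshift (m + (m + m)) i) = None.
Proof. by rewrite [i]ord1. Qed.

Let labelX (i : 'I_m) :
  nth None labels (rshift 1 (lshift (m + m) i)) = Some (0%N, i).
Proof. exact: nth_block. Qed.

Let labelA (i : 'I_m) :
  nth None labels (rshift 1 (rshift m (lshift m i))) = Some (1%N, i).
Proof. by rewrite /labels /= labels_rshift nth_block. Qed.

Let labelH (i : 'I_m) :
  nth None labels (rshift 1 (rshift m (rshift m i))) = Some (2%N, i).
Proof.
rewrite /labels /= (labels_rshift _ (rshift m i)) /= labels_rshift.
by rewrite -[[seq _ | _ <- _]]cats0 nth_block.
Qed.

Let labelS (i : 'I_(m + (m + m))) :
  exists p, nth None labels (rshift 1 i) = Some p.
Proof.
case: (split_ordP i) => j ->; first by rewrite labelX; eexists.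
by case: (split_ordP j) => k ->; rewrite ?labelA ?labelH; eexists.
Qed.

Lemma gadget_sym : A^T = A -> gadget^T = gadget.
Proof.
move=> symA; apply/matrixP=> i j; rewrite !mxE.
have A_C k l : A k l = A l k by rewrite -{1}symA mxE.
have mem k : (k < 1 + (m + (m + m)))%N ->
    if nth None labels k is Some (t, _) then (t < 3)%N else true.
  rewrite -size_labels => /(mem_nth None).
  by rewrite inE !mem_cat => /or4P[/eqP->|||] // /mapP[l _ ->].
move: (mem i (ltn_ord i)) (mem j (ltn_ord j)).
case: (nth _ _ i) => [[t k]|]; case: (nth _ _ j) => [[t' l]|] //=.
rewrite /label_op eq_sym; case: (eqVneq k l) => [->|ne] /=.
  by case: t t' => [|[|[]]] // [|[|[]]].
by case: t t' => [|[|[]]] // [|[|[]]] //= _ _; rewrite A_C.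
Qed.

Lemma det_gadget_mx : A^T = A ->
  \det (map_mx (@entry_poly F m) gadget) = c%:MP * \det (pivot_mx T A).
Proof.
move=> symA; rewrite -(det_gadget F2 T symA); set X := diag_mx _.
set tau := diag_mx _; set B := block_mx X _ _ _.
have Xk (i j : 'I_m) : X i j = entry_poly (if i != j then inl 0 else inr i : entry F m).
  by rewrite !mxE; case: eqVneq => [->|] /=; rewrite ?mpolyC0 ?mulr1n.
have tk (i j : 'I_m) : (map_mx (@mpolyC m F) tau) i j =
    entry_poly (if i != j then inl 0 else inl (T i)%:R : entry F m).
  by rewrite !mxE; case: eqVneq => [->|] /=; rewrite ?mulr1n ?mulr0n.
have sk (i j : 'I_m) : (map_mx (@mpolyC m F) (1%:M - tau)) i j =
    entry_poly (if i != j then inl 0 else inl (~~ T i)%:R : entry F m).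
  rewrite !mxE; case: eqVneq => [->|] /=; rewrite ?mulr1n ?mulr0n ?subr0 //.
  by case: (T j); rewrite ?subrr ?subr0.
have -> : map_mx (@entry_poly F m) gadget = block_mx (c%:MP)%:M 0 0 B.
  rewrite -[LHS]submxK; congr block_mx.
  - by apply/matrixP=> i j; rewrite !mxE !label0 [i]ord1 [j]ord1 eqxx mulr1n.
  - apply/matrixP=> i j; have [[t k] lab] := labelS j.
    by rewrite !mxE label0 lab /= mpolyC0.
  - apply/matrixP=> i j; have [[t k] lab] := labelS i.
    by rewrite !mxE label0 lab /= mpolyC0.
  rewrite /B map_row_mx map_col_mx map_block_mx -[LHS]submxK; congr block_mx.
  - by apply/matrixP=> i j; rewrite Xk !mxE !labelX.
  - rewrite -[LHS]hsubmxK; congr row_mx; apply/matrixP=> i j.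
      by rewrite sk !mxE labelX labelA.
    by rewrite tk !mxE labelX labelH.
  - rewrite -[LHS]vsubmxK; congr col_mx; apply/matrixP=> i j.
      by rewrite sk !mxE labelX labelA.
    by rewrite tk !mxE labelX labelH.
  rewrite -[LHS]submxK; congr block_mx; apply/matrixP=> i j.
  - by rewrite !mxE !labelA.
  - by rewrite tk !mxE labelA labelH.
  - by rewrite tk !mxE labelA labelH.
  by rewrite sk !mxE !labelH.
by rewrite det_ublock det_scalar1.
Qed.

End Gadget.

(** * Polynomial-time functions on trees *)

Section PolynomialBounds.
Local Open Scope nat_scope.

(** Monotonicity allows a bound to be applied to an upper bound on the size. The base n + 1 leaves
    room for a positive value at n = 0. *)
Definition poly_bounded (B : nat -> nat) :=
  {homo B : x y / x <= y} /\ exists c d, forall n, B n <= c * n.+1 ^ d.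

Lemma poly_bounded_cst k : poly_bounded (fun=> k).
Proof. by split=> //; exists k, 0 => n; rewrite muln1. Qed.

Lemma poly_bounded_id : poly_bounded id.
Proof. by split=> //; exists 1, 1 => n; rewrite mul1n expn1. Qed.

Lemma poly_boundedD B C :
  poly_bounded B -> poly_bounded C -> poly_bounded (fun n => B n + C n).
Proof.
move=> [mB [c [d leB]]] [mC [c' [d' leC]]]; split=> [x y xy|].
  by rewrite leq_add ?mB ?mC.
exists (c + c'), (d + d') => n; rewrite mulnDl; apply: leq_add.
  by apply: leq_trans (leB n) _; rewrite leq_mul2l leq_pexp2l ?leq_addr ?orbT.
by apply: leq_trans (leC n) _; rewrite leq_mul2l leq_pexp2l ?leq_addl ?orbT.
Qed.

Lemma poly_boundedM B C :
  poly_bounded B -> poly_bounded C -> poly_bounded (fun n => B n * C n).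
Proof.
move=> [mB [c [d leB]]] [mC [c' [d' leC]]]; split=> [x y xy|].
  by rewrite leq_mul ?mB ?mC.
by exists (c * c'), (d + d') => n; rewrite expnD mulnACA leq_mul.
Qed.

Lemma poly_bounded_comp B C :
  poly_bounded B -> poly_bounded C -> poly_bounded (fun n => B (C n)).
Proof.
move=> [mB [c [d leB]]] [mC [c' [d' leC]]]; split=> [x y xy|]; first exact/mB/mC.
(* From C n + 1 <= (c' + 1) (n + 1)^d'. *)
exists (c * c'.+1 ^ d), (d' * d) => n; apply: leq_trans (leB _) _.
rewrite expnM -mulnA -expnMn leq_mul2l; apply/orP; right.
case: d {leB} => // d; rewrite leq_exp2r // mulSn.
have := leC n; have: 0 < n.+1 ^ d' by rewrite expn_gt0.
lia.
Qed.

End PolynomialBounds.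

(** * Closure properties of polynomial time *)

Section PolynomialTime.
Local Open Scope nat_scope.

Definition code_at (p : program) (k : nat) (D : program) :=
  exists a b, p = a ++ D ++ b /\ size a = k.

Lemma code_at_cons p k e D :
  code_at p k (e :: D) -> nth ELeaf p k = e /\ code_at p k.+1 D.
Proof.
move=> [a [b [-> <-]]]; rewrite nth_cat ltnn subnn; split=> //.
by exists (rcons a e), b; rewrite cat_rcons size_rcons.
Qed.

Lemma code_at_cat p k D D' :
  code_at p k (D ++ D') -> code_at p k D /\ code_at p (k + size D) D'.
Proof.
move=> [a [b [-> <-]]]; split; first by exists a, (D' ++ b); rewrite -catA.
by exists (a ++ D), b; rewrite size_cat !catA.
Qed.

(* The code is a function of the address at which it is loaded, since the
   calls of the language are to absolute addresses. *)
Definition ptime (f : tree -> tree) :=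
  exists (D : nat -> program) (n : nat) (B : nat -> nat),
    [/\ poly_bounded B, forall k, size (D k) = n &
        forall p k, code_at p k (D k) -> forall x, exists2 t,
          eval p [:: x] (nth ELeaf p k) (f x) t & t <= B (tree_size x)].

(** Evaluation takes at least as long as the size of its value, so a time bound also bounds the size
    of the output. *)
Lemma ptime_size f : ptime f ->
  exists2 B, poly_bounded B & forall x, tree_size (f x) <= B (tree_size x).
Proof.
move=> [D [n [B [pB _ runD]]]]; exists B => // x.
have cD : code_at (D 0) 0 (D 0) by exists [::], [::]; rewrite cats0.
by have [t ev le_t] := runD _ _ cD x; apply: leq_trans (eval_size ev) le_t.
Qed.

Definition tfst (x : tree) : tree := if x is Node a _ then a else Leaf.
Definition tsnd (x : tree) : tree := if x is Node _ b then b else Leaf.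
Definition tif (c x y : tree) : tree := if c is Node _ _ then x else y.

(** The step receives the whole remaining suffix and not just its head; [tiota] relies on this to
    count. *)
Fixpoint trec (b : tree) (s : tree -> tree -> tree) (l : tree) : tree :=
  if l is Node _ l' then s l (trec b s l') else b.

Lemma ptime_id : ptime id.
Proof.
exists (fun=> [:: EVar 0]), 1, id; split=> // [|p k cp x].
  exact: poly_bounded_id.
have [-> _] := code_at_cons cp; exists (tree_size x) => //.
exact: (eval_var p [:: x] 0).
Qed.

Fixpoint quote (v : tree) : exp :=
  if v is Node a b then ENode (quote a) (quote b) else ELeaf.

Lemma eval_quote p env v : eval p env (quote v) v (tree_size v).
Proof. by elim: v => [|a IHa b IHb]; constructor. Qed.

Lemma ptime_cst v : ptime (fun=> v).
Proof.
exists (fun=> [:: quote v]), 1, (fun=> tree_size v); split=> // [|p k cp x].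
  exact: poly_bounded_cst.
by have [-> _] := code_at_cons cp; exists (tree_size v) => //; apply: eval_quote.
Qed.

(** The calling function sits at address k and the code of the components follows, so they are
    called at k + 1 and k + 1 + n. The same layout serves the other combinators. *)
Lemma ptime_comp f g : ptime f -> ptime g -> ptime (fun x => f (g x)).
Proof.
move=> [D [n [B [pB szD runD]]]] [D' [n' [B' [pB' szD' runD']]]].
exists (fun k => ECall k.+1 (ECall (k.+1 + n) (EVar 0)) ::
                 D k.+1 ++ D' (k.+1 + n)), (n + n').+1,
       (fun s => s + B' s + 2 + B (B' s)); split.
- do ![apply: poly_boundedD | exact: poly_bounded_id | done
      | exact: poly_bounded_cst | exact: poly_bounded_comp].
- by move=> k; rewrite /= size_cat szD szD'.
move=> p k /code_at_cons[-> /code_at_cat[cD]]; rewrite szD => cD' x.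
have [t' ev' le_t'] := runD' _ _ cD' x.
have [t ev le_t] := runD _ _ cD (g x).
exists ((tree_size x + t').+1 + t).+1.
  by apply: eval_call ev; apply: eval_call ev'; apply: (eval_var p [:: x] 0).
have := pB.1 _ _ (leq_trans (eval_size ev') le_t'); lia.
Qed.

Lemma ptime_node f g : ptime f -> ptime g -> ptime (fun x => Node (f x) (g x)).
Proof.
move=> [D [n [B [pB szD runD]]]] [D' [n' [B' [pB' szD' runD']]]].
exists (fun k => ENode (ECall k.+1 (EVar 0)) (ECall (k.+1 + n) (EVar 0)) ::
                 D k.+1 ++ D' (k.+1 + n)), (n + n').+1,
       (fun s => (s + B s) + (s + B' s) + 3); split.
- by do ![apply: poly_boundedD | exact: poly_bounded_id
      | exact: poly_bounded_cst].
- by move=> k; rewrite /= size_cat szD szD'.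
move=> p k /code_at_cons[-> /code_at_cat[cD]]; rewrite szD => cD' x.
have [t' ev' le_t'] := runD' _ _ cD' x.
have [t ev le_t] := runD _ _ cD x.
exists ((tree_size x + t).+1 + (tree_size x + t').+1).+1; last by lia.
by apply: eval_node; [apply: eval_call ev | apply: eval_call ev'];
  apply: (eval_var p [:: x] 0).
Qed.

Lemma ptime_proj e f c :
  (forall p x, exists2 t, eval p [:: x] e (f x) t & t <= c * tree_size x) ->
  ptime f.
Proof.
move=> runf; exists (fun=> [:: e]), 1, (fun n => c * n); split=> //.
  by apply: poly_boundedM; [apply: poly_bounded_cst | apply: poly_bounded_id].
by move=> p k cp x; have [-> _] := code_at_cons cp; apply: runf.
Qed.

Lemma tree_size_gt0 x : 0 < tree_size x.
Proof. by case: x. Qed.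

Lemma ptime_tfst : ptime tfst.
Proof.
apply: (@ptime_proj (ECase (EVar 0) ELeaf (EVar 0)) _ 3) => p x.
case: x => [|a b].
  exists 3 => //; apply: (@eval_case_leaf p _ _ _ _ _ 1 1); last exact: eval_leaf.
  exact: (eval_var p [:: Leaf] 0).
exists (tree_size (Node a b) + tree_size a).+1; last by rewrite /=; lia.
apply: (@eval_case_node p _ _ _ _ a b); first exact: (eval_var p [:: Node a b] 0).
exact: (eval_var p [:: a, b & _] 0).
Qed.

Lemma ptime_tsnd : ptime tsnd.
Proof.
apply: (@ptime_proj (ECase (EVar 0) ELeaf (EVar 1)) _ 3) => p x.
case: x => [|a b].
  exists 3 => //; apply: (@eval_case_leaf p _ _ _ _ _ 1 1); last exact: eval_leaf.
  exact: (eval_var p [:: Leaf] 0).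
exists (tree_size (Node a b) + tree_size b).+1; last by rewrite /=; lia.
apply: (@eval_case_node p _ _ _ _ a b); first exact: (eval_var p [:: Node a b] 0).
exact: (eval_var p [:: a, b & _] 1).
Qed.

Lemma ptime_fst f : ptime f -> ptime (fun x => tfst (f x)).
Proof. exact: ptime_comp ptime_tfst. Qed.

Lemma ptime_snd f : ptime f -> ptime (fun x => tsnd (f x)).
Proof. exact: ptime_comp ptime_tsnd. Qed.

Lemma ptime_if c f g : ptime c -> ptime f -> ptime g ->
  ptime (fun x => tif (c x) (f x) (g x)).
Proof.
move=> [E [l [C [pC szE runE]]]] [D [n [B [pB szD runD]]]].
move=> [D' [n' [B' [pB' szD' runD']]]].
exists (fun k => ECase (ECall k.+1 (EVar 0)) (ECall (k.+1 + l + n) (EVar 0))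
                   (ECall (k.+1 + l) (EVar 2)) ::
                 E k.+1 ++ D (k.+1 + l) ++ D' (k.+1 + l + n)), (l + (n + n')).+1,
       (fun s => (s + C s) + (s + (B s + B' s)) + 3); split.
- by do ![apply: poly_boundedD | exact: poly_bounded_id
      | exact: poly_bounded_cst].
- by move=> k; rewrite /= !size_cat szE szD szD'.
move=> p k /code_at_cons[-> /code_at_cat[cE /code_at_cat]].
rewrite szE szD => -[cD cD'] x.
have [t ev le_t] := runE _ _ cE x.
have evx : eval p [:: x] (EVar 0) x (tree_size x) := eval_var p [:: x] 0.
have [t1 ev1 le_t1] := runD _ _ cD x.
have [t2 ev2 le_t2] := runD' _ _ cD' x.
case cx: (c x) ev => [|a b] ev /=.
  exists ((tree_size x + t).+1 + (tree_size x + t2).+1).+1; last by lia.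
  by apply: eval_case_leaf; [apply: eval_call ev | apply: eval_call ev2].
exists ((tree_size x + t).+1 + (tree_size x + t1).+1).+1; last by lia.
apply: eval_case_node; first by apply: eval_call ev.
by apply: eval_call ev1; apply: (eval_var p [:: a, b, x & _] 2).
Qed.

(** The bound C on intermediate results is essential: iterating a polynomial-time step could
    otherwise produce values of exponential size. *)
Lemma ptime_rec_uncurried b s C :
  ptime b -> ptime (fun y => s (tfst y) (tfst (tsnd y)) (tsnd (tsnd y))) ->
  poly_bounded C ->
  (forall x l, tree_size (trec (b x) (s x) l) <= C (tree_size (Node x l))) ->
  ptime (fun y => trec (b (tfst y)) (s (tfst y)) (tsnd y)).
Proof.
move=> [D [n [B [pB szD runD]]]] [D' [n' [B' [pB' szD' runD']]]] pC szC.
pose body k := ECase (EVar 0) (ECall k.+1 ELeaf)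
  (ECase (EVar 1) (ECall k.+1 (EVar 0))
     (ECall (k.+1 + n) (ENode (EVar 2) (ENode (EVar 3)
        (ECall k (ENode (EVar 2) (EVar 1))))))).
(* Bounds one unfolding: the base case, the step on an argument of size at most 2 N + C N, and the
   copying of variables. The extra B 1 + 20 below pays for the input [Leaf]. *)
pose K N := B N + B' (N + N + C N) + (10 * N + 20).
exists (fun k => body k :: D k.+1 ++ D' (k.+1 + n)), (n + n').+1,
       (fun N => N * K N + (B 1 + 20)).
have pK : poly_bounded K.
  rewrite /K; apply: poly_boundedD; last first.
    by apply: poly_boundedD; last exact: poly_bounded_cst; apply: poly_boundedM;
      [apply: poly_bounded_cst | apply: poly_bounded_id].
  apply: poly_boundedD pB _; apply: poly_bounded_comp pB' _.
  by apply: poly_boundedD pC; apply: poly_boundedD; apply: poly_bounded_id.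
split.
- apply: poly_boundedD (poly_bounded_cst _).
  exact: poly_boundedM poly_bounded_id pK.
- by move=> k; rewrite /= size_cat szD szD'.
move=> p k /code_at_cons[nth_k /code_at_cat[cD]]; rewrite szD => cD'.
case=> [|x l].
  have [t ev le_t] := runD _ _ cD Leaf.
  exists (1 + (1 + t).+1).+1; last by rewrite [tree_size _]/=  in le_t *; lia.
  rewrite nth_k; apply: eval_case_leaf; first exact: (eval_var p [:: Leaf] 0).
  by apply: eval_call ev; apply: eval_leaf.
set N := tree_size (Node x l).
(* N stays fixed during the induction, so that every unfolding is charged the same K N. *)
suff runN l' : tree_size (Node x l') <= N -> exists2 t,
    eval p [:: Node x l'] (nth ELeaf p k) (trec (b x) (s x) l') t &
    t <= tree_size l' * K N.
  have [t ev le_t] := runN l (leqnn _); exists t => //; apply: leq_trans le_t _.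
  by apply: leq_trans (leq_addr _ _); rewrite leq_mul2r /N /= ltnW ?orbT // ltnS leq_addl.
elim: l' => [|a _ l' IH] le_N.
  have [t ev le_t] := runD _ _ cD x.
  exists (tree_size (Node x Leaf) + (1 + (tree_size x + t).+1).+1).+1.
    rewrite nth_k; apply: eval_case_node; first exact: (eval_var p [:: Node x Leaf] 0).
    apply: eval_case_leaf; first exact: (eval_var p [:: x, Leaf & _] 1).
    by apply: eval_call ev; apply: (eval_var p [:: x & _] 0).
  rewrite /= in le_N; rewrite mul1n /K /=.
  have : B (tree_size x) <= B N by case: pB => mB _; apply: mB; lia.
  lia.
have [|t ev le_t] := IH; first by rewrite /= in le_N *; lia.
have [t' ev' le_t'] := runD' _ _ cD'
  (Node x (Node (Node a l') (trec (b x) (s x) l'))).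
rewrite /= in ev' le_N le_t' *.
exists ((tree_size x + tree_size (Node a l')).+1 +
  (tree_size (Node a l') +
    ((tree_size x + (tree_size (Node a l') +
       ((tree_size x + tree_size l').+1 + t).+1).+1).+1 + t').+1).+1).+1.
  rewrite nth_k; apply: eval_case_node.
    exact: (eval_var p [:: Node x (Node a l')] 0).
  apply: eval_case_node; first exact: (eval_var p [:: x, Node a l' & _] 1).
  apply: eval_call ev'; apply: eval_node; first exact: (eval_var p [:: a, l', x & _] 2).
  apply: eval_node; first exact: (eval_var p [:: a, l', x, Node a l' & _] 3).
  apply: eval_call ev; apply: eval_node; first exact: (eval_var p [:: a, l', x & _] 2).
  exact: (eval_var p [:: a, l' & _] 1).
have szr : tree_size (trec (b x) (s x) l') <= C N.
  by apply: leq_trans (szC x l') _; case: pC => mC _; apply: mC; rewrite /=; lia.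
have leB' : t' <= B' (N + N + C N).
  by apply: leq_trans le_t' _; case: pB' => mB _; apply: mB; lia.
suff leK : 3 * tree_size x + 3 * (tree_size a + tree_size l').+1 +
    tree_size l' + t' + 12 <= K N.
  have le1 : K N + t <= (tree_size a + tree_size l').+1 * K N.
    by rewrite mulSn leq_add2l; apply: leq_trans le_t _; rewrite leq_mul2r leq_addl orbT.
  have szN : tree_size (Node a l') = (tree_size a + tree_size l').+1 by [].
  rewrite !szN; lia.
rewrite /K; lia.
Qed.

Lemma ptime_rec b s l C :
  ptime b -> ptime (fun y => s (tfst y) (tfst (tsnd y)) (tsnd (tsnd y))) ->
  ptime l -> poly_bounded C ->
  (forall x l', tree_size (trec (b x) (s x) l') <= C (tree_size x + tree_size l')) ->
  ptime (fun x => trec (b x) (s x) (l x)).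
Proof.
move=> pb ps pl pC szC.
apply: (ptime_comp (f := fun y => trec (b (tfst y)) (s (tfst y)) (tsnd y))
  (g := fun x => Node x (l x))); last exact: ptime_node ptime_id pl.
apply: (ptime_rec_uncurried pb ps pC) => x l'.
by apply: leq_trans (szC x l') _; apply: pC.1.
Qed.

End PolynomialTime.

(** * Lists and unary numbers as trees *)

Section TreeFunctions.
Local Open Scope nat_scope.

Definition tmapl (f : tree -> tree) (l : tree) : tree :=
  trec Leaf (fun l acc => Node (f l) acc) l.
Definition tmap (f : tree -> tree) (l : tree) : tree :=
  tmapl (fun l => f (tfst l)) l.
Definition tcat (l l' : tree) : tree :=
  trec l' (fun l acc => Node (tfst l) acc) l.
Definition tdrop (l k : tree) : tree := trec l (fun _ acc => tsnd acc) k.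
Definition tnth (l k : tree) : tree := tfst (tdrop l k).
(** On unary numbers [tdrop] is truncated subtraction, and two numbers are equal when both
    differences vanish. *)
Definition teq (a b : tree) : tree :=
  tif (tdrop a b) Leaf (tif (tdrop b a) Leaf (enc_nat 1)).
(** The suffix of length k of the unary number n is mapped to n - k, which gives 0, ..., n - 1 in
    this order. *)
Definition tiota (n : tree) : tree := tmapl (tdrop n) n.

Lemma ptime_mapl f l : ptime (fun y => f (tfst y) (tsnd y)) -> ptime l ->
  ptime (fun x => tmapl (f x) (l x)).
Proof.
move=> pf pl; have [B pB szB] := ptime_size pf.
(* There are at most N items, each of size at most B (N + 1), plus one node per item. *)
apply: (@ptime_rec (fun=> Leaf) (fun x l acc => Node (f x l) acc) l
  (fun N => N * (B N.+1 + 1))) => //.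
- exact: ptime_cst.
- apply: ptime_node; last exact/ptime_snd/ptime_snd/ptime_id.
  apply: (ptime_comp (g := fun y => Node (tfst y) (tfst (tsnd y))) pf).
  by apply: ptime_node; do ?[apply: ptime_fst | apply: ptime_snd]; apply: ptime_id.
- apply: poly_boundedM; first exact: poly_bounded_id.
  apply: poly_boundedD (poly_bounded_cst _).
  apply: (poly_bounded_comp (C := fun n => n.+1) pB).
  rewrite (_ : (fun n => n.+1) = fun n => 1 + n) //.
  exact: poly_boundedD (poly_bounded_cst _) poly_bounded_id.
move=> x l'; set N := _ + _.
suff le_rec l0 : tree_size l0 <= tree_size l' ->
    tree_size (trec Leaf (fun l acc => Node (f x l) acc) l0) <=
    tree_size l0 * (B N.+1 + 1).
  apply: leq_trans (le_rec _ (leqnn _)) _.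
  by rewrite leq_mul2r leq_addl orbT.
elim: l0 => [|a _ l0 IH] /= le_l0; first by lia.
have := IH (leq_trans _ le_l0); move/(_ ltac:(lia)).
have : tree_size (f x (Node a l0)) <= B N.+1.
  by apply: leq_trans (szB (Node x (Node a l0))) (pB.1 _ _ _); rewrite /N /=; lia.
move: (B N.+1) => b; move: (tree_size (trec _ _ _)) (tree_size (f _ _)) => u v.
rewrite mulSn mulnDl; have := tree_size_gt0 a; nia.
Qed.

Lemma ptime_map f l : ptime (fun y => f (tfst y) (tsnd y)) -> ptime l ->
  ptime (fun x => tmap (f x) (l x)).
Proof.
move=> pf; apply: (ptime_mapl (f := fun x l => f x (tfst l))).
apply: (ptime_comp (g := fun y => Node (tfst y) (tfst (tsnd y))) pf).
by apply: ptime_node; do ?[apply: ptime_fst | apply: ptime_snd]; apply: ptime_id.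
Qed.

Lemma ptime_cat l l' : ptime l -> ptime l' -> ptime (fun x => tcat (l x) (l' x)).
Proof.
move=> pl pl'; have [B pB szB] := ptime_size pl'.
apply: (@ptime_rec l' (fun _ l acc => Node (tfst l) acc) l
  (fun N => B N + N)) => //.
- by apply: ptime_node; do ?[apply: ptime_fst | apply: ptime_snd]; apply: ptime_id.
- exact: poly_boundedD pB poly_bounded_id.
move=> x l0.
suff : tree_size (trec (l' x) (fun l acc => Node (tfst l) acc) l0) <=
    B (tree_size x) + tree_size l0.
  by have := pB.1 _ _ (leq_addr (tree_size l0) (tree_size x)); lia.
elim: l0 => [|a _ l0 IH] /=; last by lia.
by apply: leq_trans (szB x) (leq_addr _ _).
Qed.

Lemma ptime_drop l k : ptime l -> ptime k -> ptime (fun x => tdrop (l x) (k x)).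
Proof.
move=> pl pk; have [B pB szB] := ptime_size pl.
apply: (@ptime_rec l (fun _ _ acc => tsnd acc) k B) => //.
  exact/ptime_snd/ptime_snd/ptime_snd/ptime_id.
move=> x k0; apply: leq_trans (pB.1 _ _ (leq_addr (tree_size k0) (tree_size x))).
elim: k0 => [|a _ k0 IH] //=; apply: leq_trans IH.
by case: (trec _ _ _) => [|u v] //=; lia.
Qed.

Lemma ptime_nth l k : ptime l -> ptime k -> ptime (fun x => tnth (l x) (k x)).
Proof. by move=> pl pk; apply: ptime_fst (ptime_drop pl pk). Qed.

Lemma ptime_eq f g : ptime f -> ptime g -> ptime (fun x => teq (f x) (g x)).
Proof.
move=> pf pg; apply: ptime_if (ptime_drop pf pg) (ptime_cst _) _.
exact: ptime_if (ptime_drop pg pf) (ptime_cst _) (ptime_cst _).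
Qed.

Lemma ptime_iota f : ptime f -> ptime (fun x => tiota (f x)).
Proof.
move=> pf; apply: (ptime_mapl (f := fun x => tdrop (f x)) _ pf).
apply: ptime_drop; last exact/ptime_snd/ptime_id.
exact: (ptime_comp pf (ptime_fst ptime_id)).
Qed.

Lemma tif_nat (b : bool) x y : tif (enc_nat b) x y = if b then x else y.
Proof. by case: b. Qed.

Lemma tmapE (T : Type) f (g : T -> tree) s :
  tmap f (enc_seq g s) = enc_seq (fun x => f (g x)) s.
Proof. by elim: s => //= x s; rewrite /tmap /tmapl /= => ->. Qed.

Lemma enc_seq_map (T U : Type) (g : U -> tree) (h : T -> U) s :
  enc_seq g (map h s) = enc_seq (fun x => g (h x)) s.
Proof. by elim: s => //= x s ->. Qed.

Lemma eq_in_enc_seq (T : eqType) (g h : T -> tree) s :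
  {in s, g =1 h} -> enc_seq g s = enc_seq h s.
Proof.
elim: s => //= x s IH eqgh; rewrite eqgh ?mem_head // IH // => y ys.
by apply: eqgh; rewrite inE ys orbT.
Qed.

Lemma tcatE (T : Type) (g : T -> tree) s s' :
  tcat (enc_seq g s) (enc_seq g s') = enc_seq g (s ++ s').
Proof. by elim: s => //= x s; rewrite /tcat /= => ->. Qed.

Lemma tdrop_seq (T : Type) (g : T -> tree) s k :
  tdrop (enc_seq g s) (enc_nat k) = enc_seq g (drop k s).
Proof.
elim: k => [|k IH]; first by rewrite drop0.
rewrite -addn1 addnC -drop_drop drop1 /tdrop /= -/(tdrop _ _) IH.
by case: (drop k s).
Qed.

Lemma tdrop_nat a b : tdrop (enc_nat a) (enc_nat b) = enc_nat (a - b).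
Proof.
elim: b => [|b IH]; first by rewrite subn0.
by rewrite subnS /tdrop /= -/(tdrop _ _) IH; case: (a - b).
Qed.

Lemma tnth_seq (T : Type) (x0 : T) (g : T -> tree) s k : k < size s ->
  tnth (enc_seq g s) (enc_nat k) = g (nth x0 s k).
Proof. by move=> lt_k; rewrite /tnth tdrop_seq (drop_nth x0). Qed.

Lemma tnth_leaf k : tnth Leaf (enc_nat k) = Leaf.
Proof. by rewrite /tnth (tdrop_seq (fun x : tree => x) [::]). Qed.

Lemma teq_nat a b : teq (enc_nat a) (enc_nat b) = enc_nat (a == b).
Proof.
rewrite /teq !tdrop_nat eqn_leq /leq.
by case: (a - b) => //; case: (b - a).
Qed.

Lemma tiota_nat n : tiota (enc_nat n) = enc_seq enc_nat (iota 0 n).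
Proof.
suff aux k : k <= n ->
    tmapl (tdrop (enc_nat n)) (enc_nat k) = enc_seq enc_nat (iota (n - k) k).
  by rewrite /tiota aux // subnn.
elim: k => // k IH lt_k; rewrite /tmapl /= -/(tmapl _ _) IH; last exact: ltnW.
by rewrite (tdrop_nat n k.+1) -(subnSK lt_k).
Qed.

Lemma tiota_ord n : tiota (enc_nat n) = enc_seq (fun i : 'I_n => enc_nat i) (enum 'I_n).
Proof. by rewrite tiota_nat -val_enum_ord enc_seq_map. Qed.

End TreeFunctions.

(** * The algorithm *)

Section Algorithm.

Variable F : finFieldType.

Definition talter (t : tree) : tree := tif t Leaf (enc_nat 1).

(** The first monomial is rebuilt exponent by exponent, so that an empty list, that is P = 0, yields
    the encoding of the monomial 1. *)
Definition thead (m l : tree) : tree := tmap (tnth (tfst (tfst l))) (tiota m).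

Definition tflip (m i u : tree) : tree :=
  tmap (fun j => tif (teq j i) (talter (tnth u j)) (tnth u j)) (tiota m).

Definition teq_monomial (m u v : tree) : tree :=
  trec (enc_nat 1)
    (fun l acc => tif (teq (tnth u (tfst l)) (tnth v (tfst l))) acc Leaf)
    (tiota m).

Definition tcoef (m l u : tree) : tree :=
  trec (enc_scalar (0 : F))
    (fun l acc => tif (teq_monomial m (tfst (tfst l)) u) (tsnd (tfst l)) acc) l.

(** The table of [f] is a constant of the program, which is possible because F is fixed. *)
Definition toperation (f : F -> F -> F) (x y : tree) : tree :=
  tnth (tnth (enc_seq (fun a => enc_seq (fun b => enc_scalar (f a b)) (enum F))
                (enum F)) x) y.

Definition tratio (m l u c : tree) : tree :=
  toperation (fun a b => a / b) (tcoef m l u) c.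

Definition tcore (m l u c i j : tree) : tree :=
  tif (teq i j) (tratio m l (tflip m i u) c)
    (toperation (fun a b => sqrtF (a + b))
       (toperation (fun a b => a * b) (tratio m l (tflip m i u) c)
          (tratio m l (tflip m j u) c))
       (tratio m l (tflip m i (tflip m j u)) c)).

Definition tconst (a : tree) : tree := Node (enc_nat 0) a.

Definition tlabel_op (t t' : tree) : tree :=
  tnth (tnth (enc_seq (enc_seq enc_nat)
    [:: [:: 1; 2; 3]; [:: 2; 0; 3]; [:: 3; 3; 2]]) t)%N t'.

Definition tentry (m l u c d d' : tree) : tree :=
  let zero := tconst (enc_scalar (0 : F)) in
  let one := tconst (enc_scalar (1 : F)) in
  let i := tsnd d in let j := tsnd d' in
  let k := tlabel_op (tfst d) (tfst d') in
  tif d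
    (tif d'
       (tif k
          (tif (teq i j)
             (tif (tsnd k)
                (tif (tsnd (tsnd k)) (tif (tnth u i) one zero)
                   (tif (tnth u i) zero one))
                (Node (enc_nat 1) i))
             zero)
          (tconst (tcore m l u c i j)))
       zero)
    (tif d' zero (tconst c)).

Definition tlabels (m : tree) : tree :=
  let s := tiota m in
  Node Leaf (tcat (tmap (Node (enc_nat 0)) s)
    (tcat (tmap (Node (enc_nat 1)) s) (tmap (Node (enc_nat 2)) s))).

Definition talgorithm (x : tree) : tree :=
  let m := tfst x in let l := tsnd x in let u := thead m l in
  let c := tcoef m l u in
  tmap (fun d => tmap (tentry m l u c d) (tlabels m)) (tlabels m).

Lemma ptime_eq_monomial m u v : ptime m -> ptime u -> ptime v ->
  ptime (fun x => teq_monomial (m x) (u x) (v x)).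
Proof.
move=> pm pu pv.
apply: (@ptime_rec (fun=> enc_nat 1)
  (fun x l acc => tif (teq (tnth (u x) (tfst l)) (tnth (v x) (tfst l))) acc Leaf)
  (* The accumulator is a truth value, and [enc_nat 1] has size 3. *)
  (fun x => tiota (m x)) (fun=> 3%N)).
- exact: ptime_cst.
- apply: ptime_if; last exact: ptime_cst.
    have p1 : ptime (fun y => tfst y) by exact: ptime_tfst.
    have p2 : ptime (fun y => tfst (tfst (tsnd y))).
      exact/ptime_fst/ptime_fst/ptime_snd/ptime_id.
    by apply: ptime_eq; apply: ptime_nth p2; apply: ptime_comp p1.
  exact/ptime_snd/ptime_snd/ptime_id.
- exact: ptime_iota.
- exact: poly_bounded_cst.
move=> x l; elim: l => [|a _ l IH] //=.
by case: (teq _ _).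
Qed.

Lemma ptime_coef m l u : ptime m -> ptime l -> ptime u ->
  ptime (fun x => tcoef (m x) (l x) (u x)).
Proof.
move=> pm pl pu.
apply: (@ptime_rec (fun=> enc_scalar (0 : F))
  (fun x l acc => tif (teq_monomial (m x) (tfst (tfst l)) (u x)) (tsnd (tfst l)) acc)
  l (fun N => (tree_size (enc_scalar (0%R : F)) + N)%N)) => //.
- exact: ptime_cst.
- apply: ptime_if.
  + apply: ptime_eq_monomial.
    * exact: ptime_comp pm ptime_tfst.
    * exact/ptime_fst/ptime_fst/ptime_fst/ptime_snd/ptime_id.
    * exact: ptime_comp pu ptime_tfst.
  + exact/ptime_snd/ptime_fst/ptime_fst/ptime_snd/ptime_id.
  exact/ptime_snd/ptime_snd/ptime_id.
- by apply: poly_boundedD; [apply: poly_bounded_cst | apply: poly_bounded_id].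
move=> x l0; elim: l0 => [|a _ l0 IH] /=; first by rewrite leq_addr.
case: (teq_monomial _ _ _) => [|? ?] /=; first by lia.
by case: a => [|? ?] /=; lia.
Qed.

Ltac solve_ptime_with lem :=
  repeat first
  [ assumption
  | apply: lem
  | exact: ptime_id
  | exact: ptime_cst
  | apply: ptime_nth
  | apply: ptime_eq
  | apply: ptime_fst
  | apply: ptime_snd
  | apply: ptime_if
  | apply: ptime_iota
  | apply: ptime_coef
  | apply: ptime_cat
  | match goal with
    | |- ptime (fun x => tmap (@?f x) (@?l x)) =>
        apply: (@ptime_map f l); cbv beta
    | |- ptime (fun x => Node (@?f x) (@?g x)) => apply: (@ptime_node f g)
    | H : ptime ?f |- ptime (fun y => ?f (@?g y)) => apply: (@ptime_comp f g H)
    end ].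

Ltac solve_ptime := solve_ptime_with ptime_id.

Lemma ptime_flip m i u : ptime m -> ptime i -> ptime u ->
  ptime (fun x => tflip (m x) (i x) (u x)).
Proof. move=> pm pi pu; rewrite /tflip /talter; solve_ptime. Qed.

Lemma ptime_operation f x y : ptime x -> ptime y ->
  ptime (fun z => toperation f (x z) (y z)).
Proof. by move=> px py; rewrite /toperation; solve_ptime. Qed.

Lemma ptime_ratio m l u c : ptime m -> ptime l -> ptime u -> ptime c ->
  ptime (fun x => tratio (m x) (l x) (u x) (c x)).
Proof.
by move=> pm pl pu pc; apply: ptime_operation => //; apply: ptime_coef.
Qed.

Lemma ptime_core m l u c i j :
  ptime m -> ptime l -> ptime u -> ptime c -> ptime i -> ptime j ->
  ptime (fun x => tcore (m x) (l x) (u x) (c x) (i x) (j x)).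
Proof.
move=> pm pl pu pc pi pj; rewrite /tcore.
apply: ptime_if; first exact: ptime_eq.
  by apply: ptime_ratio => //; apply: ptime_flip.
apply: ptime_operation; last by apply: ptime_ratio => //; do 2![apply: ptime_flip => //].
by apply: ptime_operation; apply: ptime_ratio => //; apply: ptime_flip.
Qed.

Lemma ptime_algorithm : ptime talgorithm.
Proof.
have pc m l u c d d' : ptime m -> ptime l -> ptime u -> ptime c -> ptime d ->
    ptime d' -> ptime (fun x => tentry (m x) (l x) (u x) (c x) (d x) (d' x)).
  move=> pm pl pu pc pd pd'; rewrite /tentry /tconst /tlabel_op; cbv zeta.
  by solve_ptime_with ptime_core.
have plab m : ptime m -> ptime (fun x => tlabels (m x)).
  by move=> pm; rewrite /tlabels; cbv zeta; solve_ptime.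
rewrite /talgorithm /thead; cbv zeta.
apply: (ptime_map (f := fun x d => tmap _ _)); last by apply: plab; solve_ptime.
apply: (ptime_map (f := fun x d => _)); last by apply: plab; solve_ptime.
by apply: pc; solve_ptime.
Qed.

End Algorithm.

(** * Correctness of the algorithm *)

Section Correctness.

Variables (F : finFieldType) (m : nat) (P : {mpoly F[m]}) (s : seq 'X_{1..m}).

Let enc_term (u : 'X_{1..m}) := Node (enc_monomial u) (enc_scalar P@_u).

Lemma tnth_monomial (u : 'X_{1..m}) (i : 'I_m) :
  tnth (enc_monomial u) (enc_nat i) = enc_nat (u i).
Proof. by rewrite (tnth_seq i) ?size_enum_ord // nth_ord_enum. Qed.

Lemma theadE : thead (enc_nat m) (enc_seq enc_term s) = enc_monomial (head 0%MM s).
Proof.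
rewrite /thead tiota_ord tmapE; apply: eq_in_enc_seq => i _.
case: s => [|u s'] /=; last exact: tnth_monomial.
by rewrite tnth_leaf mnm0E.
Qed.

Lemma tflipE (i : 'I_m) (u : 'X_{1..m}) :
  tflip (enc_nat m) (enc_nat i) (enc_monomial u) = enc_monomial (flip i u).
Proof.
rewrite /tflip tiota_ord tmapE; apply: eq_in_enc_seq => j _.
rewrite teq_nat tif_nat tnth_monomial mnmE (inj_eq val_inj).
by case: eqP => // _; case: (u j) => //= k; rewrite subn0.
Qed.

Lemma teq_monomialE (u v : 'X_{1..m}) :
  teq_monomial (enc_nat m) (enc_monomial u) (enc_monomial v) = enc_nat (u == v).
Proof.
have -> : (u == v) = all (fun i => u i == v i) (enum 'I_m).
  apply/eqP/allP => [-> //|equv]; apply/mnmP=> i.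
  by apply/eqP/equv; rewrite mem_enum.
rewrite /teq_monomial tiota_ord; elim: (enum _) => //= i e ->.
by rewrite !tnth_monomial teq_nat tif_nat; case: eqP.
Qed.

Lemma tcoefE (u : 'X_{1..m}) :
  tcoef F (enc_nat m) (enc_seq enc_term s) (enc_monomial u) =
  enc_scalar (if u \in s then P@_u else 0).
Proof.
rewrite /tcoef; elim: s => //= v s' ->.
by rewrite teq_monomialE tif_nat inE eq_sym; case: eqP => [->|].
Qed.

Lemma toperationE (f : F -> F -> F) (a b : F) :
  toperation f (enc_scalar a) (enc_scalar b) = enc_scalar (f a b).
Proof.
rewrite /toperation /enc_scalar (tnth_seq 0) -?cardE ?ltn_ord //.
by rewrite (tnth_seq 0) -?cardE ?ltn_ord // !nth_enum_rank.
Qed.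

Hypothesis s_supp : s =i msupp P.

Lemma tcoef_supp (u : 'X_{1..m}) :
  tcoef F (enc_nat m) (enc_seq enc_term s) (enc_monomial u) = enc_scalar P@_u.
Proof. by rewrite tcoefE s_supp mcoeff_msupp; case: eqP => [->|]. Qed.

Let T := head 0%MM s.

Lemma tcoreE (i j : 'I_m) :
  tcore F (enc_nat m) (enc_seq enc_term s) (enc_monomial T) (enc_scalar P@_T)
    (enc_nat i) (enc_nat j) = enc_scalar (SDR_core P T i j).
Proof.
rewrite /tcore /tratio teq_nat tif_nat !tflipE !tcoef_supp !toperationE mxE.
by rewrite (inj_eq val_inj); case: eqP.
Qed.

Definition enc_label (d : label m) : tree :=
  if d is Some (t, i) then Node (enc_nat t) (enc_nat i) else Leaf.

Lemma tlabelsE : tlabels (enc_nat m) = enc_seq enc_label (labels m).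
Proof.
rewrite /tlabels /labels tiota_ord !tmapE /=; congr (Node _ _).
by rewrite -!tcatE !enc_seq_map.
Qed.

Lemma tlabel_opE t t' : (t < 3)%N -> (t' < 3)%N ->
  tlabel_op (enc_nat t) (enc_nat t') = enc_nat (label_op t t').
Proof. by case: t t' => [|[|[]]] // [|[|[]]]. Qed.

Lemma labels_lt3 d : d \in labels m -> if d is Some (t, _) then (t < 3)%N else true.
Proof.
by rewrite inE !mem_cat => /or4P[/eqP->|||] // /mapP[l _ ->].
Qed.

(** The program tests whether an exponent is nonzero, the gadget whether it equals 1; these agree
    for exponents at most 1. *)
Lemma tentryE d d' : (forall i, T i <= 1)%N -> d \in labels m -> d' \in labels m ->
  tentry F (enc_nat m) (enc_seq enc_term s) (enc_monomial T) (enc_scalar P@_T)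
    (enc_label d) (enc_label d') =
  enc_entry (gadget_entry (fun i => T i == 1%N) (SDR_core P T) P@_T d d').
Proof.
move=> T1 /labels_lt3 + /labels_lt3.
case: d d' => [[t i]|] [[t' j]|] //= lt_t lt_t'.
rewrite /tentry /= tlabel_opE // tcoreE teq_nat tif_nat (inj_eq val_inj) tnth_monomial.
case: (label_op t t') => [|[|[|k]]] //=; case: eqP => //= _.
  by case: (T i) (T1 i) => [|[]].
by case: (T i) (T1 i) => [|[]].
Qed.

Lemma talgorithmE : (forall i, T i <= 1)%N ->
  talgorithm F (enc_poly P s) =
  enc_matrix (gadget (fun i => T i == 1%N) (SDR_core P T) P@_T).
Proof.
move=> T1; rewrite /talgorithm /enc_poly /= -/enc_term theadE -/T tcoef_supp tlabelsE.
pose n := (1 + (m + (m + m)))%N.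
have labE : labels m = [seq nth None (labels m) i | i : 'I_n <- enum 'I_n].
  rewrite (map_comp (nth None (labels m)) val) val_enum_ord /n -size_labels.
  by rewrite -/(mkseq _ _) mkseq_nth.
have lab_in (i : 'I_n) : nth None (labels m) i \in labels m.
  by rewrite mem_nth // size_labels.
have enc_labels f : enc_seq f (labels m) =
    enc_seq (fun i : 'I_n => f (nth None (labels m) i)) (enum 'I_n).
  by rewrite {1}labE enc_seq_map.
rewrite tmapE enc_labels; apply: eq_in_enc_seq => i _.
rewrite tmapE enc_labels; apply: eq_in_enc_seq => j _.
by rewrite tentryE // mxE.
Qed.

End Correctness.

(** * Input size and conclusion *)

Lemma tree_size_enc_nat n : tree_size (enc_nat n) = (n.*2).+1.
Proof. by elim: n => //= n ->; lia. Qed.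

Lemma tree_size_enc_seq (T : eqType) (f : T -> tree) s k :
  {in s, forall x, tree_size (f x) <= k}%N ->
  (tree_size (enc_seq f s) <= (size s) * k.+1 + 1)%N.
Proof.
elim: s => //= x s IH le_k; have := le_k x (mem_head _ _).
have /IH : {in s, forall x, tree_size (f x) <= k}%N.
  by move=> y ys; apply: le_k; rewrite inE ys orbT.
by rewrite mulSn; lia.
Qed.

Theorem theorem5p10 (F : finFieldType) (F2 : 2%N \in [pchar F]) :
  exists (p : program) (c d : nat),
    forall (m : nat) (P : {mpoly F[m]}) (s : seq 'X_{1..m}),
      multilinear P -> perm_eq s (msupp P) ->
      exists (v : tree) (t : nat),
        [/\ run p (enc_poly P s) v t,
            (t <= c * (m + size (msupp P)).+1 ^ d)%N &
            (exists (n : nat) (M : 'M[entry F m]_n), is_SDR P M) ->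
            exists (n : nat) (M : 'M[entry F m]_n),
              v = enc_matrix M /\ is_SDR P M].
Proof.
have [D [_ [B [pB _ runD]]]] := ptime_algorithm F.
(* [K] bounds the size of a scalar and [N] that of the input. By multilinearity each exponent has
   size at most 3, so a monomial takes at most 4 m + 1. *)
pose K := (#|F|.*2 + 1)%N.
pose N n := (2 * n + 1 + (n * (n * 4 + 1 + K + 2) + 1) + 1)%N.
have pN : poly_bounded N.
  rewrite /N; apply: poly_boundedD (poly_bounded_cst _).
  apply: poly_boundedD.
    apply: poly_boundedD (poly_bounded_cst _).
    exact: poly_boundedM (poly_bounded_cst _) poly_bounded_id.
  apply: poly_boundedD (poly_bounded_cst _).
  apply: poly_boundedM poly_bounded_id _.
  do 3![apply: poly_boundedD (poly_bounded_cst _)].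
  exact: poly_boundedM poly_bounded_id (poly_bounded_cst _).
have [_ [c [d le_BN]]] : poly_bounded (fun n => N n + B (N n) + 2)%N.
  apply: poly_boundedD (poly_bounded_cst _).
  exact: poly_boundedD pN (poly_bounded_comp pB pN).
exists (D 0%N), c, d => m P s mlP ps.
have cD : code_at (D 0%N) 0 (D 0%N) by exists [::], [::]; rewrite cats0.
have s_supp : s =i msupp P := perm_mem ps.
have [t ev le_t] := runD _ _ cD (enc_poly P s).
set T := head 0%MM s.
have T1 i : (T i <= 1)%N.
  rewrite /T; case es: s => [|u s'] /=; first by rewrite mnm0E.
  by apply: mlP; rewrite -s_supp es mem_head.
(* A nonempty [s] puts T in the support; an empty one means P = 0. *)
have T0 : P@_T = 0 -> P = 0.
  move/eqP; rewrite -[_ == 0]negbK -mcoeff_msupp -s_supp /T => Ts.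
  apply/eqP; rewrite -msupp_eq0 -size_eq0 -(perm_size ps) size_eq0.
  by case: s Ts {ps s_supp ev le_t T T1} => //= u s'; rewrite mem_head.
exists (talgorithm F (enc_poly P s)), (tree_size (enc_poly P s) + t).+1; split.
- by apply: eval_call ev; apply: (eval_var (D 0%N) [:: enc_poly P s] 0).
- set n := (m + size (msupp P))%N.
  have szP : (tree_size (enc_poly P s) <= N n)%N.
    have sz_term : {in s, forall u : 'X_{1..m}, tree_size (Node (enc_monomial u)
        (enc_scalar P@_u)) <= n * 4 + 1 + K + 1}%N.
      move=> u us /=.
      have szu : (tree_size (enc_monomial u) <= m * 4 + 1)%N.
        have := @tree_size_enc_seq _ (fun i : 'I_m => enc_nat (u i)) (enum 'I_m) 3.
        rewrite size_enum_ord; apply => i _; rewrite tree_size_enc_nat.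
        have : (u i <= 1)%N by apply: mlP; rewrite -s_supp.
        by case: (u i) => [|[]].
      have szc : (tree_size (enc_scalar P@_u) <= K)%N.
        by rewrite tree_size_enc_nat /K addn1 ltnS leq_double ltnW.
      rewrite /n; lia.
    have := tree_size_enc_seq sz_term; rewrite (perm_size ps) /=.
    rewrite tree_size_enc_nat /N => szs.
    have le_mul : (size (msupp P) * (n * 4 + 1 + K + 1).+1 <= n * (n * 4 + 1 + K + 2))%N.
      by apply: leq_mul; [apply: leq_addl | rewrite addn1 addn2].
    have le_m : (m <= n)%N by exact: leq_addr.
    lia.
  apply: leq_trans (le_BN n).
  have := pB.1 _ _ szP; lia.
(* The algorithm returns the gadget in every case; the existence of a representation ensures that
   its determinant is P. *)
case=> n [M sdrM]; pose A := SDR_core P T.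
exists _, (gadget (fun i => T i == 1%N) A P@_T); split; first exact: talgorithmE.
split=> //; first by apply: gadget_sym; apply: SDR_core_sym.
rewrite det_gadget_mx //; last exact: SDR_core_sym.
by rewrite -(SDR_core_det F2 mlP sdrM T1 T0).
Qed.
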